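(* Let $(H_0,H_1,H_2)$ be a Hilbert space triple and let $s\in[0,1)$. Let $U_1,V_1\subset H_1$ be open subsets and let $\phi\colon U_1\to V_1$ be an $s$-Floeromorphism. Let $f\colon V_1\to\mathbb{R}$ be a Floer function. Then the composition $f\circ\phi\colon U_1\to\mathbb{R}$ is a Floer function.
   Context: **Spaces.** $\mathcal{L}(X,Y)$ denotes bounded linear maps with the operator norm, $\mathcal{L}(X)=\mathcal{L}(X,X)$, and $\mathcal{L}(X,Y;Z)$ denotes bounded bilinear maps $X\times Y\to Z$ with its norm. A Hilbert space triple $(H_0,H_1,H_2)$ consists of real Hilbert spaces $H_2\subset H_1\subset H_0$ such that both inclusions are dense and compact. $\langle\cdot,\cdot\rangle_0$ is the inner product of $H_0$. $H_{-1}$ is the completion of $H_0$ in the norm $\|\eta\|_{-1}=\sup_{0\ne\xi\in H_1}|\langle\eta,\xi\rangle_0|/\|\xi\|_1$. For $s\in[0,1]$, $H_s$ is the Hilbert interpolation space between $H_0$ and $H_1$: if $\Lambda$ is the positive self-adjoint operator on $H_0$ with domain $H_1$ and $\|\Lambda\xi\|_0=\|\xi\|_1$, then $H_s=\mathrm{dom}(\Lambda^s)$ with norm $\|\Lambda^s\xi\|_0$. Likewise $H_{1+s}$ is the corresponding interpolation space between $H_1$ and $H_2$. For an open subset $U_1\subset H_1$ put $U_2:=U_1\cap H_2$, an open subset of $H_2$. **Floer map.** Let $s\in[0,1)$ and let $U_1,V_1\subset H_1$ be open. A map $\phi\colon U_1\to V_1$ is two-level $\mathrm{ssc}^2$ if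 $\phi$ is $C^2$ (in the $H_1$-topology), $\phi(U_2)\subset V_2$, and the restriction $\phi_2\colon U_2\to V_2$ is $C^2$ in the $H_2$-topology. A two-level $\mathrm{ssc}^2$ map $\phi\colon U_1\to V_1$ is an $s$-Floer map if: (i)$_1$ For every $q\in U_1$ the derivative $d\phi|_q\in\mathcal{L}(H_1)$ extends to some $D\phi|_q\in\mathcal{L}(H_0)$, and $U_1\to\mathcal{L}(H_0)$, $q\mapsto D\phi|_q$, is $C^1$. (i)$_2$ For every $q\in U_2$ the operator $D\phi|_q\in\mathcal{L}(H_0)$ extends further to an element of $\mathcal{L}(H_{-1})$, still denoted $D\phi|_q$, and $U_2\to\mathcal{L}(H_{-1})$, $q\mapsto D\phi|_q$, is $C^1$. (ii)$_1$ For every $q\in U_1$ the second derivative $d^2\phi|_q\in\mathcal{L}(H_1,H_1;H_1)$ extends to some $D^2\phi|_q\in\mathcal{L}(H_s,H_0;H_0)$, and $U_1\to\mathcal{L}(H_s,H_0;H_0)$, $q\mapsto D^2\phi|_q$, is continuous. (ii)$_2$ For every $q\in U_2$ the restriction of $D^2\phi|_q$ to $H_{1+s}\times H_0$ extends to an element of $\mathcal{L}(H_{1+s},H_{-1};H_{-1})$, still denoted $D^2\phi|_q$, and $U_2\to\mathcal{L}(H_{1+s},H_{-1};H_{-1})$, $q\mapsto D^2\phi|_q$, is continuous. An $s$-Floeromorphism is a bijective $s$-Floer map $U_1\to V_1$ whose inverse $V_1\to U_1$ is also an $s$-Floer map. **Floer function.** Let $U_1\subset H_1$ be open and $f\colon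 U_1\to\mathbb{R}$ a $C^2$ function. A Floer gradient of $f$ is a map $\nabla f\colon U_1\to H_0$ such that: $df|_q\xi=\langle\nabla f|_q,\xi\rangle_0$ for all $q\in U_1$, $\xi\in H_1$; the restriction of $\nabla f$ to $U_2$ takes values in $H_1$; and both maps $U_1\to H_0$, $q\mapsto\nabla f|_q$, and $U_2\to H_1$, $q\mapsto\nabla f|_q$, are $C^1$. A Floer Hessian of $f$ is a family of operators $A^q\in\mathcal{L}(H_1,H_0)$, $q\in U_1$, such that: $d^2f|_q(\xi,\eta)=\langle A^q\xi,\eta\rangle_0$ for all $q\in U_1$, $\xi,\eta\in H_1$; for each $q\in U_2$ the restriction of $A^q$ to $H_2$ takes values in $H_1$ and is bounded as a map $A^q_2\colon H_2\to H_1$; both maps $U_1\to\mathcal{L}(H_1,H_0)$, $q\mapsto A^q$, and $U_2\to\mathcal{L}(H_2,H_1)$, $q\mapsto A^q_2$, are continuous; for every $q\in U_1$ the operator $A^q\colon H_1\to H_0$ is Fredholm of index zero, and for every $q\in U_2$ the operator $A^q_2\colon H_2\to H_1$ is Fredholm of index zero. $f$ is a Floer function if it is $C^2$ and admits a Floer gradient and a Floer Hessian. *)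

(* Defs.v *)
From HB Require Import structures.
From mathcomp Require Import all_boot all_order all_algebra.
From mathcomp Require Import all_classical all_reals all_analysis.

Set Implicit Arguments.
Unset Strict Implicit.
Unset Printing Implicit Defensive.

Import Order.TTheory GRing.Theory Num.Theory.
Import numFieldNormedType.Exports.

Local Open Scope classical_set_scope.
Local Open Scope ring_scope.

Reserved Notation "''L' ( V , W )" (at level 0, format "''L' ( V ,  W )").

(** Bounded linear maps with the operator norm. *)

Section BoundedLinear.
Context {R : realType} (V W : normedModType R).

Definition bounded_linear : {pred V -> W} :=
  mem [set f : V -> W | linear f /\ continuous f].

Record blin := Blin { blfun :> V -> W ; blinP : blfun \in bounded_linear }.

HB.instance Definition _ := [isSub for blfun].
HB.instance Definition _ := [Choice of blin by <:].

Lemma bounded_linear_submod : submod_closed bounded_linear.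
Proof.
split=> [|a f g].
  rewrite inE; split=> [a x y|]; last exact: cst_continuous.
  by rewrite /= scaler0 addr0.
rewrite !inE => -[lf cf] [lg cg]; split=> [b x y|x].
  change (a *: f (b *: x + y) + g (b *: x + y) =
          b *: (a *: f x + g x) + (a *: f y + g y)).
  by rewrite lf lg !scalerDr !scalerA [b * a]mulrC addrACA.
apply: (@continuousD _ _ _ (a \*: f) g); last exact: cg.
by apply: continuousZr; exact: cf.
Qed.

HB.instance Definition _ := GRing.isSubmodClosed.Build R (V -> W)
  bounded_linear bounded_linear_submod.
HB.instance Definition _ := [SubChoice_isSubLmodule of blin by <:].

Lemma blin_linear (f : blin) : linear f.
Proof. by have := blinP f; rewrite inE => -[]. Qed.

HB.instance Definition _ (f : blin) :=
  GRing.isLinear.Build R V W *:%R (blfun f) (@blin_linear f).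

Lemma blin_continuous (f : blin) : continuous f.
Proof. by have := blinP f; rewrite inE => -[]. Qed.

Lemma blin_addE (f g : blin) x : (f + g) x = f x + g x.
Proof. by []. Qed.

Lemma blin_scaleE a (f : blin) x : (a *: f) x = a *: f x.
Proof. by []. Qed.

Definition opnorm (f : blin) : R := sup [set `|f x| | x in [set x | `|x| <= 1]].

Lemma opnorm_has_sup (f : blin) :
  has_sup [set `|f x| | x in [set x | `|x| <= 1]].
Proof.
split; first by exists `|f 0|, 0 => //=; rewrite normr0.
have /linear_boundedP/pinfty_ex_gt0[M M0 fM] :=
  (linear_bounded_continuous f).2 (@blin_continuous f).
exists M => _ [x /= x1 <-]; apply: le_trans (fM x) _.
by rewrite ler_piMr// ltW.
Qed.

Lemma opnorm_ub (f : blin) x : `|x| <= 1 -> `|f x| <= opnorm f.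
Proof. by move=> x1; apply: ub_le_sup; [case: (opnorm_has_sup f)|exists x]. Qed.

Lemma opnormP (f : blin) x : `|f x| <= opnorm f * `|x|.
Proof.
have [->|x0] := eqVneq x 0; first by rewrite raddf0 !normr0 mulr0.
have := @opnorm_ub f (`|x|^-1 *: x).
rewrite linearZ/= !normrZ normfV normr_id mulVf ?normr_eq0// => /(_ (lexx _)).
by rewrite ler_pdivrMl ?normr_gt0// mulrC.
Qed.

Lemma opnorm_le (f : blin) M : (forall x, `|x| <= 1 -> `|f x| <= M) ->
  opnorm f <= M.
Proof.
move=> fM; apply: ge_sup; first by case: (opnorm_has_sup f).
by move=> _ [x /= x1 <-]; exact: fM.
Qed.

Lemma opnorm_ge0 (f : blin) : 0 <= opnorm f.
Proof. by apply: le_trans (@opnorm_ub f 0 _); rewrite ?normr0. Qed.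

Lemma opnormD (f g : blin) : opnorm (f + g) <= opnorm f + opnorm g.
Proof.
apply: opnorm_le => x x1; rewrite blin_addE (le_trans (ler_normD _ _))//.
by rewrite lerD// opnorm_ub.
Qed.

Let opnormZ_le a (f : blin) : opnorm (a *: f) <= `|a| * opnorm f.
Proof.
by apply: opnorm_le => x x1; rewrite blin_scaleE normrZ ler_wpM2l// opnorm_ub.
Qed.

Lemma opnormZ a (f : blin) : opnorm (a *: f) = `|a| * opnorm f.
Proof.
apply/eqP; rewrite eq_le opnormZ_le/=.
have [->|a0] := eqVneq a 0; first by rewrite normr0 mul0r opnorm_ge0.
have := opnormZ_le a^-1 (a *: f).
by rewrite scalerA mulVf// scale1r normfV -ler_pdivrMl ?invr_gt0 ?normr_gt0// invrK.
Qed.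

Lemma opnorm_eq0 (f : blin) : opnorm f = 0 -> f = 0.
Proof.
move=> f0; apply: val_inj; apply/funext => x /=; apply/normr0_eq0/le_anti.
by rewrite normr_ge0 andbT (le_trans (opnormP f x))// f0 mul0r.
Qed.

HB.instance Definition _ :=
  @Lmodule_isNormed.Build R blin opnorm opnormD opnormZ opnorm_eq0.

Lemma blin_normE (f : blin) : `|f| = opnorm f.
Proof. by []. Qed.

End BoundedLinear.

Notation "''L' ( V , W )" := (blin V W) : type_scope.

(** Maps of class C^k on an open set [U], given by total functions whose values
    outside [U] are irrelevant. *)

Section Smooth.
Context {R : realType} {V W : normedModType R}.

(* Only meaningful when ['d f x] is bounded, e.g. when [f] is differentiable
   at [x]; the value is 0 otherwise. *)
Definition Diff (f : V -> W) (x : V) : 'L(V, W) := insubd 0 ('d f x : V -> W).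

Lemma DiffE (f : V -> W) (x : V) : differentiable f x ->
  Diff f x = 'd f x :> (V -> W).
Proof.
move=> df; rewrite /Diff insubdK// inE; split; first exact: linearP.
exact: diff_continuous.
Qed.

Definition C1_on (U : set V) (f : V -> W) :=
  (forall x, U x -> differentiable f x) /\ {within U, continuous (Diff f)}.

End Smooth.

Section Smooth2.
Context {R : realType} {V W : normedModType R}.

Definition C2_on (U : set V) (f : V -> W) := C1_on U f /\ C1_on U (Diff f).

(* [Diff2 f x v w] is the second derivative at [x] in the directions [v], [w];
   ['L(X, 'L(Y, Z))] plays the role of the bounded bilinear maps X x Y -> Z. *)
Definition Diff2 (f : V -> W) (x : V) : 'L(V, 'L(V, W)) := Diff (Diff f) x.

End Smooth2.

Section Fredholm.
Context {R : realType} {X Y : normedModType R}.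
Implicit Types A : 'L(X, Y).

Definition ker_dim A (n : nat) := exists v : 'I_n -> X,
  forall x, A x = 0 <-> exists! c : 'rV[R]_n, x = \sum_(i < n) c 0 i *: v i.

Definition coker_dim A (m : nat) := exists w : 'I_m -> Y,
  forall y, exists! c : 'rV[R]_m,
    exists x, y = A x + \sum_(i < m) c 0 i *: w i.

(* Between Banach spaces the range is then automatically closed. *)
Definition fredholm_of_index A (k : int) := exists n m : nat,
  [/\ ker_dim A n, coker_dim A m & k = n%:Z - m%:Z].

End Fredholm.

(** Real Hilbert spaces. *)

HB.mixin Record NormedModule_isHilbert (R : realType) V
    of CompleteNormedModule R V := {
  ip : {dot V for (idfun : R -> R)} ;
  sqr_normE : forall x : V, `|x| ^+ 2 = ip x x
}.

#[short(type="hilbertType")]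
HB.structure Definition Hilbert (R : realType) :=
  {V of CompleteNormedModule R V & NormedModule_isHilbert R V}.

(* Inclusions of spaces are injective bounded linear maps. *)
Definition dense_compact_inclusion (R : realType) (Y X : hilbertType R)
    (i : 'L(Y, X)) :=
  [/\ injective i, dense (range i) &
      forall B : set Y, bounded_set B -> precompact (i @` B)].

Record hilbert_triple (R : realType) := HilbertTriple {
  H0 : hilbertType R ;
  H1 : hilbertType R ;
  H2 : hilbertType R ;
  i10 : 'L(H1, H0) ;
  i21 : 'L(H2, H1) ;
  i10P : dense_compact_inclusion i10 ;
  i21P : dense_compact_inclusion i21
}.

(* A completion of [H0] for the norm |.|_{-1}: a Banach space in which [H0]
   sits densely and with that norm; it is unique up to unique isometry. *)
Record neg_completion (R : realType) (T : hilbert_triple R) := NegCompletion {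
  Hm1 : completeNormedModType R ;
  jm1 : {linear H0 T -> Hm1} ;
  jm1_dense : dense (range jm1) ;
  jm1_norm : forall eta : H0 T, `|jm1 eta| =
    sup [set `|ip eta (i10 T xi)| / `|xi| | xi in [set xi : H1 T | xi != 0]]
}.

(** Interpolation spaces. *)

Section Interpolation.
Context {R : realType} {Y X : hilbertType R}.
Implicit Types (i : 'L(Y, X)) (L : {linear Y -> X}).

(* [L] is seen as an unbounded operator on [X] with domain [i(Y)]. The first
   condition says that the graph of the adjoint of [L] is the graph of [L]. *)
Definition positive_selfadjoint i L :=
  (forall x w : X, (forall y : Y, ip (L y) x = ip (i y) w) <->
                   (exists z : Y, i z = x /\ L z = w)) /\
  (forall y : Y, 0 <= ip (L y) (i y)).

(* [frac_pow i L s x w] means that [x] is in dom(L^s) and [w = L^s x].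
   When [i] is compact, [L] has an orthonormal basis of eigenvectors, in which
   the functional calculus acts diagonally. *)
Definition eigenbasis i L (I : choiceType) (e : I -> Y) (l : I -> R) :=
  [/\ forall k, L (e k) = l k *: i (e k),
      forall k k', ip (i (e k)) (i (e k')) = (k == k')%:R &
      forall x : X, (forall k, ip x (i (e k)) = 0) -> x = 0].

Definition frac_pow i L (s : R) (x w : X) :=
  exists (I : choiceType) (e : I -> Y) (l : I -> R), eigenbasis i L e l /\
    forall k, ip w (i (e k)) = l k `^ s * ip x (i (e k)).

(* A realization of the interpolation space between [X] and [Y] as a normed
   space over its inclusion into [X]; the last two conditions determine it up
   to unique isometry (in particular they imply completeness). *)
Record interp_space i (s : R) := InterpSpace {
  interp_op : {linear Y -> X} ;
  interp_op_sa : positive_selfadjoint i interp_op ;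
  interp_op_norm : forall y : Y, `|interp_op y| = `|y| ;
  interp_car :> normedModType R ;
  interp_incl : {linear interp_car -> X} ;
  interp_dom : forall x : X, (exists h, interp_incl h = x) <->
                             (exists w, frac_pow i interp_op s x w) ;
  interp_norm : forall h w, frac_pow i interp_op s (interp_incl h) w ->
                            `|h| = `|w|
}.

End Interpolation.

(** Floer maps. *)

Section FloerMap.
Context {R : realType} (T : hilbert_triple R) (N : neg_completion T) (s : R).
Context (Hs : interp_space (i10 T) s) (H1s : interp_space (i21 T) s).
Implicit Types U V : set (H1 T).

Definition level2 U : set (H2 T) := i21 T @^-1` U.

Definition two_level_ssc2 U V (phi : H1 T -> H1 T) :=
  [/\ forall q, U q -> V (phi q),
      C2_on U phi &
      exists phi2 : H2 T -> H2 T,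
        (forall q, level2 U q -> i21 T (phi2 q) = phi (i21 T q)) /\
        C2_on (level2 U) phi2].

(* The extensions [D], [Dm] of the first derivative and [D2], [D2m] of the
   second one are unique on [U] and [level2 U], by density. Vectors of
   different spaces are identified by comparing their images in [H0]. *)
Definition floer_map U V (phi : H1 T -> H1 T) :=
  two_level_ssc2 U V phi /\
  exists (D : H1 T -> 'L(H0 T, H0 T)) (Dm : H2 T -> 'L(Hm1 N, Hm1 N))
         (D2 : H1 T -> 'L(Hs, 'L(H0 T, H0 T)))
         (D2m : H2 T -> 'L(H1s, 'L(Hm1 N, Hm1 N))),
  [/\ (forall q, U q -> forall xi, D q (i10 T xi) = i10 T (Diff phi q xi)) /\
      C1_on U D,
      (forall q, level2 U q ->
         forall eta, Dm q (jm1 N eta) = jm1 N (D (i21 T q) eta)) /\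
      C1_on (level2 U) Dm,
      (forall q, U q -> forall (x : Hs) (xi eta : H1 T),
         interp_incl Hs x = i10 T xi ->
         D2 q x (i10 T eta) = i10 T (Diff2 phi q xi eta)) /\
      {within U, continuous D2} &
      (forall q, level2 U q -> forall (y : H1s) (x : Hs) (eta : H0 T),
         interp_incl Hs x = i10 T (interp_incl H1s y) ->
         D2m q y (jm1 N eta) = jm1 N (D2 (i21 T q) x eta)) /\
      {within level2 U, continuous D2m}].

Definition floeromorphism U V (phi : H1 T -> H1 T) :=
  floer_map U V phi /\
  exists psi : H1 T -> H1 T,
    [/\ floer_map V U psi,
        forall q, U q -> psi (phi q) = q &
        forall p, V p -> phi (psi p) = p].

End FloerMap.

(** Floer functions. *)

Section FloerFunction.
Context {R : realType} (T : hilbert_triple R).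
Implicit Types (U : set (H1 T)) (f : H1 T -> R^o).

Definition floer_gradient U f (g : H1 T -> H0 T) :=
  [/\ forall q, U q -> forall xi, Diff f q xi = ip (g q) (i10 T xi),
      C1_on U g &
      exists g2 : H2 T -> H1 T,
        (forall q, level2 U q -> i10 T (g2 q) = g (i21 T q)) /\
        C1_on (level2 U) g2].

Definition floer_hessian U f (A : H1 T -> 'L(H1 T, H0 T)) :=
  [/\ forall q, U q ->
        forall xi eta, Diff2 f q xi eta = ip (A q xi) (i10 T eta),
      {within U, continuous A},
      forall q, U q -> fredholm_of_index (A q) 0 &
      exists A2 : H2 T -> 'L(H2 T, H1 T),
        [/\ forall q, level2 U q ->
              forall xi, i10 T (A2 q xi) = A (i21 T q) (i21 T xi),
            {within level2 U, continuous A2} &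
            forall q, level2 U q -> fredholm_of_index (A2 q) 0]].

Definition floer_function U f :=
  [/\ C2_on U f, exists g, floer_gradient U f g &
      exists A, floer_hessian U f A].

End FloerFunction.

(* Main.v *)
Require Import Defs.
From HB Require Import structures.
From mathcomp Require Import all_boot all_order all_algebra.
From mathcomp Require Import all_classical all_reals all_analysis.
From mathcomp Require Import ring lra.

(** A Floeromorphism [phi] pulls [f] back to [F = f \o phi] with
    - [grad F q = (Dphi_q)^* (grad f (phi q))],
    - [A_F^q xi = (Dphi_q)^* (A^(phi q) (dphi_q xi))
                  + (D^2phi_q (iota xi))^* (grad f (phi q))],
    where [iota] is the embedding of [H1] into [H_s]. On the second level the
    same formulas hold with the adjoint on [L(H0)] replaced by the transpose
    [L(H_{-1}) -> L(H1)] coming from the duality between [H_{-1}] and [H1]; so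
    regularity reduces to the chain rule for bounded bilinear expressions.

    The first summand of [A_F^q] is [A^(phi q)] composed with isomorphisms, and
    the second is compact because [s < 1]: the scalar inequality
    [l^s <= e l + C] gives [|iota xi|_s <= e |xi|_1 + C |xi|_0], and the
    inclusion of [H1] into [H0] is compact. Index zero operators are the bounded
    bijections plus finite rank operators, and compact operators are finite rank
    plus small ones, which yields the stability of index zero under compact
    perturbations. *)

Set Implicit Arguments.
Unset Strict Implicit.
Unset Printing Implicit Defensive.

Import Order.TTheory GRing.Theory Num.Theory.
Import numFieldNormedType.Exports.

Local Open Scope classical_set_scope.
Local Open Scope ring_scope.

(** * Bounded linear maps *)

Section BoundedLinearMaps.
Context {R : realType}.
Implicit Types V W X Y Z : normedModType R.

Lemma blin_ext V W (f g : 'L(V, W)) : f =1 g -> f = g.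
Proof. by move=> fg; apply: val_inj; apply/funext. Qed.

Lemma blin0 V W (f : 'L(V, W)) : f 0 = 0.
Proof. exact: raddf0. Qed.

Lemma blinD V W (f : 'L(V, W)) x y : f (x + y) = f x + f y.
Proof. exact: raddfD. Qed.

Lemma blinB V W (f : 'L(V, W)) x y : f (x - y) = f x - f y.
Proof. exact: raddfB. Qed.

Lemma blinZ V W (f : 'L(V, W)) a x : f (a *: x) = a *: f x.
Proof. exact: linearZ. Qed.

Lemma blin_sum V W (f : 'L(V, W)) (I : Type) (r : seq I) (P : pred I)
    (F : I -> V) : f (\sum_(k <- r | P k) F k) = \sum_(k <- r | P k) f (F k).
Proof. exact: raddf_sum. Qed.

(** A linear map is continuous as soon as it is bounded. The conclusion is a sigma type so that
    [sval] can define operators from it. *)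
Lemma blin_ex V W (f : V -> W) (C : R) : linear f ->
  (forall x, `|f x| <= C * `|x|) -> {F : 'L(V, W) | forall x, F x = f x}.
Proof.
move=> lf fC.
pose fl : {linear V -> W} := HB.pack f (GRing.isLinear.Build _ _ _ _ _ lf).
suff fP : f \in @bounded_linear _ V W by exists (Blin fP).
rewrite inE; split=> //.
change (continuous fl).
apply/linear_bounded_continuous/linear_boundedP.
near=> M => x; apply: le_trans (fC x) _; rewrite ler_wpM2r//.
Unshelve. all: by end_near. Qed.

Lemma blin_norm_le V W (f : 'L(V, W)) (C : R) : 0 <= C ->
  (forall x, `|f x| <= C * `|x|) -> `|f| <= C.
Proof.
move=> C0 fC; rewrite blin_normE; apply: opnorm_le => x x1.
by apply: le_trans (fC x) _; rewrite ler_piMr.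
Qed.

Lemma blin_normP V W (f : 'L(V, W)) x : `|f x| <= `|f| * `|x|.
Proof. exact: opnormP. Qed.

(** Bounded bilinear maps in curried form. Composition, flip and adjoint are all built from this, so
    that the regularity of expressions in them reduces to one rule for bilinear maps. *)
Lemma blin2_ex V W Z (b : V -> W -> Z) (C : R) :
  (forall v, linear (b v)) -> (forall w, linear (b^~ w)) ->
  0 <= C -> (forall v w, `|b v w| <= C * `|v| * `|w|) ->
  {B : 'L(V, 'L(W, Z)) | forall v w, B v w = b v w}.
Proof.
move=> bl br C0 bC.
pose g v : 'L(W, Z) := sval (blin_ex (bl v) (bC v)).
have gE v w : g v w = b v w by exact: svalP (blin_ex (bl v) (bC v)) w.
have gl : linear g.
  by move=> a x y; apply: blin_ext => w; rewrite blin_addE blin_scaleE !gE br.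
have gC v : `|g v| <= C * `|v|.
  by apply: blin_norm_le => [|w]; rewrite ?mulr_ge0// gE bC.
by exists (sval (blin_ex gl gC)) => v w; rewrite (svalP (blin_ex gl gC)) gE.
Qed.

Section Composition.
Variables V W Z : normedModType R.

Fact bcomp_ex : {B : 'L('L(W, Z), 'L('L(V, W), 'L(V, Z))) |
  forall g f x, B g f x = g (f x)}.
Proof.
have ex (g : 'L(W, Z)) (f : 'L(V, W)) :
    {h : 'L(V, Z) | forall x, h x = g (f x)}.
  apply: (@blin_ex _ _ (g \o f) (`|g| * `|f|)).
    by move=> a x y /=; rewrite !linearP.
  move=> x /=; apply: le_trans (blin_normP _ _) _.
  by rewrite -mulrA ler_wpM2l// blin_normP.
pose bc g f := sval (ex g f).
have bcE g f x : bc g f x = g (f x) by exact: svalP (ex g f) x.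
have [||||B BE] := @blin2_ex _ _ _ bc 1.
- by move=> g a x y; apply: blin_ext => w; rewrite blin_addE blin_scaleE !bcE linearP.
- by move=> g a x y; apply: blin_ext => w; rewrite blin_addE blin_scaleE !bcE.
- exact: ler01.
- move=> g f; rewrite mul1r; apply: blin_norm_le => [|x]; first by rewrite mulr_ge0.
  rewrite bcE; apply: le_trans (blin_normP _ _) _.
  by rewrite -mulrA ler_wpM2l// blin_normP.
by exists B => g f x; rewrite BE bcE.
Qed.

Definition bcomp := sval bcomp_ex.

Lemma bcompE g f x : bcomp g f x = g (f x).
Proof. exact: svalP bcomp_ex g f x. Qed.

Fact bflip_ex (B : 'L(V, 'L(W, Z))) :
  {B' : 'L(W, 'L(V, Z)) | forall w v, B' w v = B v w}.
Proof.
apply: (@blin2_ex _ _ _ (fun w v => B v w) `|B|) => //.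
- by move=> w a x y; rewrite linearP.
- by move=> w a x y; rewrite linearP.
- move=> w v; apply: le_trans (blin_normP _ _) _.
  by rewrite mulrAC ler_wpM2r// blin_normP.
Qed.

Definition bflip B := sval (bflip_ex B).

Lemma bflipE B w v : bflip B w v = B v w.
Proof. exact: svalP (bflip_ex B) w v. Qed.

End Composition.

Fact bid_ex V : {I : 'L(V, V) | forall x, I x = x}.
Proof. by apply: (@blin_ex _ _ id 1) => // x; rewrite mul1r. Qed.

Definition bid V := sval (bid_ex V).

Lemma bidE V (x : V) : bid V x = x.
Proof. exact: svalP (bid_ex V) x. Qed.

Definition beval V W : 'L(V, 'L('L(V, W), W)) := bflip (bid 'L(V, W)).

Lemma bevalE V W (x : V) (f : 'L(V, W)) : beval V W x f = f x.
Proof. by rewrite bflipE bidE. Qed.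

Lemma dense_norm V (S : set V) : dense S ->
  forall (x : V) (e : R), 0 < e -> exists2 y, S y & `|x - y| < e.
Proof.
move=> dS x e e0; have [||y [xy Sy]] := dS (ball x e).
- by exists x; exact: ballxx.
- exact: ball_open.
- by exists y => //; move: xy; rewrite -ball_normE.
Qed.

Lemma norm_dense V (S : set V) :
  (forall (x : V) (e : R), 0 < e -> exists2 y, S y & `|x - y| < e) -> dense S.
Proof.
move=> dS O [x Ox] oO.
have /nbhs_ballP[e /= e0 xeO] := open_nbhs_nbhs (conj oO Ox).
have [y Sy xy] := dS x e e0; exists y; split=> //; apply: xeO.
by rewrite -ball_normE.
Qed.

Lemma le0_small (x C : R) : 0 <= C -> (forall e : R, 0 < e -> x <= C * e) -> x <= 0.
Proof.
move=> C0 xC; rewrite leNgt; apply/negP => x0.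
(* For this [e] one has [C * e <= x / 2 < x]; the [+ 1] covers [C = 0]. *)
have := xC (x / (C + 1) / 2); rewrite !divr_gt0 ?ltr_wpDl// => /(_ isT).
rewrite leNgt => /negP; apply.
have C1 : 0 < C + 1 by lra.
rewrite !mulrA ltr_pdivrMr// ltr_pdivrMr//; nra.
Qed.

Lemma norm_small_eq0 V (x : V) (C : R) : 0 <= C ->
  (forall e : R, 0 < e -> `|x| <= C * e) -> x = 0.
Proof. by move=> C0 xC; apply/eqP; rewrite -normr_le0 (le0_small C0 xC). Qed.

Lemma eq_blin_dense V W (S : set V) (f g : 'L(V, W)) : dense S ->
  (forall x, S x -> f x = g x) -> f = g.
Proof.
move=> dS fg; apply: blin_ext => x; apply/eqP; rewrite -subr_eq0; apply/eqP.
apply: (@norm_small_eq0 _ _ (`|f| + `|g|)); first by rewrite addr_ge0.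
move=> e e0; have [y Sy xy] := dense_norm dS x e0.
have -> : f x - g x = f (x - y) - g (x - y).
  by rewrite !blinB (fg _ Sy) opprB addrA addrNK.
apply: le_trans (ler_normB _ _) _; rewrite mulrDl.
apply: lerD; apply: le_trans (blin_normP _ _) _; exact/ler_wpM2l/ltW.
Qed.

Lemma cauchy_seq_cvg (Z : completeNormedModType R) (w : nat -> Z) :
  (forall e : R, 0 < e -> exists N, forall n m, (N <= n)%N -> (N <= m)%N ->
     `|w n - w m| < e) ->
  exists l, forall e : R, 0 < e -> exists N, forall n, (N <= n)%N -> `|l - w n| < e.
Proof.
move=> wc.
have : cvg (w @ \oo).
  apply: cauchy_cvg; apply: cauchy_exP => e e0.
  have [N HN] := wc e e0; exists (w N); rewrite /fmapE -ball_normE.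
  by exists N => // m /= Nm; apply: HN.
rewrite cvg_ex => -[l /cvgrPdist_lt wl]; exists l => e e0.
by have [N _ HN] := wl e e0; exists N.
Qed.

Lemma inv_nat_lt (e : R) : 0 < e -> exists N, forall n, (N <= n)%N -> n.+1%:R^-1 < e.
Proof.
move=> e0; exists (Num.truncn e^-1) => n Nn.
rewrite -[e]invrK ltf_pV2 ?posrE ?invr_gt0//.
by apply: lt_le_trans (truncnS_gt _) _; rewrite ler_nat.
Qed.

End BoundedLinearMaps.

Arguments bcomp {R V W Z}.

(** * Extension by continuity of a densely defined bounded graph *)

Section Extension.
Context {R : realType} (X : normedModType R) (Z : completeNormedModType R).
Variables (G : X -> Z -> Prop) (C : R).
Hypothesis C0 : 0 <= C.
Hypothesis G_lin : forall a x y z w, G x z -> G y w -> G (a *: x + y) (a *: z + w).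
Hypothesis G_bnd : forall x z, G x z -> `|z| <= C * `|x|.
Hypothesis G_dense : forall x (e : R), 0 < e -> exists y, `|x - y| < e /\ exists w, G y w.

Let Gc x z := forall e : R, 0 < e -> exists y w, [/\ G y w, `|x - y| < e & `|z - w| < e].

Let Gc_ex x : exists z, Gc x z.
Proof.
have [y Hy] := choice (fun n : nat => @G_dense x n.+1%:R^-1 ltac:(by rewrite invr_gt0)).
have [w Hw] := choice (fun n => (Hy n).2).
have [|l Hl] := @cauchy_seq_cvg _ Z w.
  move=> e e0.
  (* From index [N] on, the [y n] are within [e / (C + 1) / 2] of [x], hence within [e / (C + 1)] of
     each other; the bound on [G] multiplies this by [C < C + 1]. *)
  have [N HN] := @inv_nat_lt R (e / (C + 1) / 2) ltac:(by rewrite !divr_gt0 ?ltr_wpDl).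
  exists N => n m Nn Nm.
  have := G_bnd (G_lin (-1) (Hw m) (Hw n)).
  rewrite !scaleN1r ![- _ + _]addrC => /le_lt_trans; apply.
  have yy : `|y n - y m| < e / (C + 1).
    rewrite -[y n](subrK x) -addrA; apply: le_lt_trans (ler_normD _ _) _.
    have := (Hy n).1; have := (Hy m).1; have := HN _ Nn; have := HN _ Nm.
    rewrite (distrC x (y n)); move: (e / (C + 1)) (n.+1%:R^-1) (m.+1%:R^-1) => u v u'; lra.
  apply: (@le_lt_trans _ _ (C * (e / (C + 1)))); first by rewrite ler_wpM2l// ltW.
  have C1 : 0 < C + 1 by have := C0; lra.
  by rewrite mulrA ltr_pdivrMr//; nra.
exists l => e e0; have [N1 HN1] := Hl e e0; have [N2 HN2] := inv_nat_lt e0.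
exists (y (maxn N1 N2)), (w (maxn N1 N2)); split.
- exact: Hw.
- by apply: lt_trans (Hy _).1 _; apply: HN2; exact: leq_maxr.
- by apply: HN1; exact: leq_maxl.
Qed.

Let Gc_lin a x y z w : Gc x z -> Gc y w -> Gc (a *: x + y) (a *: z + w).
Proof.
move=> xz yw e e0; have a1 : 0 < `|a| + 1 by rewrite ltr_wpDl.
have d0 : 0 < e / (`|a| + 1) by rewrite divr_gt0.
have [x' [z' [G1 H1 H2]]] := xz _ d0.
have [y' [w' [G2 H3 H4]]] := yw _ d0.
have key (V : normedModType R) (u v u' v' : V) : `|u - u'| < e / (`|a| + 1) ->
    `|v - v'| < e / (`|a| + 1) -> `|a *: u + v - (a *: u' + v')| < e.
  move=> uu vv; rewrite opprD addrACA -scalerBr.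
  apply: le_lt_trans (ler_normD _ _) _; rewrite normrZ.
  have -> : e = `|a| * (e / (`|a| + 1)) + e / (`|a| + 1).
    by rewrite -{2}[e / _]mul1r -mulrDl mulrC divfK// gt_eqF.
  by rewrite ler_ltD// ler_wpM2l// ltW.
by exists (a *: x' + y'), (a *: z' + w'); split; [exact: G_lin|exact: key|exact: key].
Qed.

Let Gc_bnd x z : Gc x z -> `|z| <= C * `|x|.
Proof.
move=> xz; rewrite -subr_le0; apply: (@le0_small _ _ (C + 1)).
  by rewrite addr_ge0.
move=> e e0; have [y [w [/G_bnd yw xy zw]]] := xz e e0.
have : `|z| <= `|z - w| + `|w| by rewrite -{1}[z](subrK w) ler_normD.
have : `|y| <= `|x - y| + `|x| by rewrite -{1}[y](subrK x) distrC ler_normD.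
by have := C0; nra.
Qed.

(** The closure [Gc] of the graph is linear with the same bound, is defined everywhere because [Z]
    is complete, and is single-valued by the bound applied to a difference over [x - x = 0]. With a
    relation as input, no function on the dense domain has to be chosen. *)
Lemma graph_extension : {K : 'L(X, Z) | forall x z, G x z -> K x = z &
  forall x, `|K x| <= C * `|x|}.
Proof.
pose k x := sval (cid (Gc_ex x)).
have kG x : Gc x (k x) by exact: svalP (cid (Gc_ex x)).
have uniq x z z' : Gc x z -> Gc x z' -> z = z'.
  move=> xz xz'; have := Gc_bnd (Gc_lin (-1) xz xz').
  rewrite !scaleN1r addNr normr0 mulr0 normr_le0 addrC subr_eq0.
  by move=> /eqP.
have kl : linear k by move=> a x y; apply: uniq (kG _) _; apply: Gc_lin.
have [K KE] := blin_ex kl (fun x => Gc_bnd (kG x)).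
exists K => x; rewrite KE; last exact: Gc_bnd.
move=> z Gxz; apply: uniq (kG x) _ => e e0.
by exists x, z; rewrite !subrr !normr0.
Qed.

End Extension.

(** * Hilbert spaces *)

Section Hilbert.
Context {R : realType}.
Implicit Types H X Y : hilbertType R.

Lemma ipC H (x y : H) : ip x y = ip y x.
Proof. by have := hermC (@ip R H) x y; rewrite expr0 mul1r. Qed.

Lemma ipDl H (x y z : H) : ip (x + y) z = ip x z + ip y z.
Proof. exact: linearDl. Qed.

Lemma ipZl H a (x z : H) : ip (a *: x) z = a * ip x z.
Proof. exact: linearZl_LR. Qed.

Lemma ipDr H (x y z : H) : ip z (x + y) = ip z x + ip z y.
Proof. by rewrite ipC ipDl !(ipC z). Qed.

Lemma ipZr H a (x z : H) : ip z (a *: x) = a * ip z x.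
Proof. by rewrite ipC ipZl ipC. Qed.

Lemma ip0l H (z : H) : ip 0 z = 0.
Proof. by rewrite -(scale0r 0) ipZl mul0r. Qed.

Lemma ip0r H (z : H) : ip z 0 = 0.
Proof. by rewrite ipC ip0l. Qed.

Lemma ipNl H (x z : H) : ip (- x) z = - ip x z.
Proof. by rewrite -scaleN1r ipZl mulN1r. Qed.

Lemma ipNr H (x z : H) : ip z (- x) = - ip z x.
Proof. by rewrite ipC ipNl ipC. Qed.

Lemma ipBl H (x y z : H) : ip (x - y) z = ip x z - ip y z.
Proof. by rewrite ipDl ipNl. Qed.

Lemma ipBr H (x y z : H) : ip z (x - y) = ip z x - ip z y.
Proof. by rewrite ipDr ipNr. Qed.

Lemma ip_suml H (I : Type) (r : seq I) (P : pred I) (F : I -> H) z :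
  ip (\sum_(k <- r | P k) F k) z = \sum_(k <- r | P k) ip (F k) z.
Proof. by elim/big_rec2: _ => [|k a b _ <-]; rewrite ?ip0l ?ipDl. Qed.

Lemma ip_sumr H (I : Type) (r : seq I) (P : pred I) (F : I -> H) z :
  ip z (\sum_(k <- r | P k) F k) = \sum_(k <- r | P k) ip z (F k).
Proof. by rewrite ipC ip_suml; apply: eq_bigr => k _; rewrite ipC. Qed.

Lemma sqr_normD H (x y : H) : `|x + y| ^+ 2 = `|x| ^+ 2 + 2 * ip x y + `|y| ^+ 2.
Proof. by rewrite !sqr_normE !ipDl !ipDr (ipC y x); ring. Qed.

Lemma sqr_normB H (x y : H) : `|x - y| ^+ 2 = `|x| ^+ 2 - 2 * ip x y + `|y| ^+ 2.
Proof. by rewrite sqr_normD ipNr normrN mulrN. Qed.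

Lemma cauchy_schwarz H (x y : H) : `|ip x y| <= `|x| * `|y|.
Proof.
have [->|y0] := eqVneq y 0; first by rewrite ip0r !normr0 mulr0.
have n0 : 0 < `|y| by rewrite normr_gt0.
(* This square expands to [|y|^2 (|x|^2 |y|^2 - (ip x y)^2)]. *)
have := sqr_ge0 (`| `|y| ^+ 2 *: x - ip x y *: y|).
rewrite sqr_normB ipZl ipZr !normrZ !exprMn !real_normK ?num_real// => le0.
rewrite -ler_sqr ?nnegrE ?mulr_ge0// exprMn real_normK ?num_real//.
have : 0 <= `|y| ^+ 2 * (`|x| ^+ 2 * `|y| ^+ 2 - ip x y ^+ 2).
  by apply: le_trans le0 _; rewrite le_eqVlt; apply/orP; left; apply/eqP; ring.
by rewrite pmulr_rge0 ?exprn_gt0// subr_ge0.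
Qed.

Lemma ip_inj H (x y : H) : (forall z, ip z x = ip z y) -> x = y.
Proof.
move=> xy; apply/eqP; rewrite -subr_eq0 -normr_eq0 -sqrf_eq0 sqr_normE.
by rewrite ipBr xy subrr.
Qed.

Lemma ip_sqrt_le H (x : H) (C : R) : 0 <= C -> ip x x <= C * `|x| -> `|x| <= C.
Proof.
move=> C0; rewrite -sqr_normE expr2; have [->//|x0] := eqVneq `|x| 0.
by rewrite ler_pM2r// lt_def x0/=.
Qed.

Lemma quadratic_ge0_eq0 (c b : R) : 0 <= c ->
  (forall t : R, 0 <= t ^+ 2 * c + 2 * t * b) -> b = 0.
Proof.
move=> c0 tb; have c1 : 0 < c + 1 by rewrite ltr_wpDl.
(* Near the minimiser [- b / c]; the denominator [c + 1] also covers [c = 0]. *)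
have := tb (- b / (c + 1)).
have -> : (- b / (c + 1)) ^+ 2 * c + 2 * (- b / (c + 1)) * b =
   - (b ^+ 2 * (c + 2) / (c + 1) ^+ 2).
  by field; rewrite gt_eqF.
rewrite oppr_ge0 pmulr_lle0 ?invr_gt0 ?exprn_gt0// pmulr_lle0 ?ltr_wpDl//.
by move=> b0; apply/eqP; rewrite -sqrf_eq0 eq_le b0 sqr_ge0.
Qed.

(* Minimise |x|^2 - 2 l x over the closed subspace M: minimising sequences are
   Cauchy by the parallelogram law. *)
Lemma riesz_subspace H (M : set H) (l : 'L(H, R^o)) :
  M 0 -> (forall a x y, M x -> M y -> M (a *: x + y)) ->
  (forall x, (forall e : R, 0 < e -> exists2 y, M y & `|x - y| < e) -> M x) ->
  exists2 u, M u & forall x, M x -> l x = ip u x.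
Proof.
move=> M0 Ml Mc; pose J x : R := `|x| ^+ 2 - 2 * l x.
(* From [l x <= |l| |x|] follows [J x >= (|x| - |l|)^2 - |l|^2]. *)
have Jlb x : - `|l| ^+ 2 <= J x.
  have := blin_normP l x; have := ler_norm (l x : R); rewrite /J.
  move: (`|x|) (`|l|) (l x : R) => a b c; rewrite -/(`|c|) => h1 h2.
  have : c <= b * a by apply: le_trans h1 h2.
  by have := sqr_ge0 (a - b); rewrite sqrrB; nra.
pose S := J @` M.
have hS : has_inf S by split; [exists (J 0), 0|exists (- `|l| ^+ 2) => _ [x _ <-]].
pose m := inf S.
have mJ x : M x -> m <= J x.
  by move=> Mx; apply: ge_inf; [case: hS|exists x].
(* Parallelogram law: [J x + J y - 2 J ((x + y) / 2) = |x - y|^2 / 2], and the midpoint lies in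
   [M]. *)
have par x y : M x -> M y -> `|x - y| ^+ 2 <= 2 * (J x - m) + 2 * (J y - m).
  move=> Mx My; have Mz : M (2^-1 *: (x + y)).
    have -> : 2^-1 *: (x + y) = 2^-1 *: x + (2^-1 *: y + 0).
      by rewrite addr0 scalerDr.
    exact: (Ml _ _ _ Mx (Ml _ _ _ My M0)).
  have := mJ _ Mz; rewrite /J normrZ blinZ blinD exprMn (sqr_normD x y) (sqr_normB x y).
  rewrite ger0_norm ?invr_ge0// /GRing.scale/=.
  move: (`|x| ^+ 2) (`|y| ^+ 2) (ip x y) (l x : R) (l y : R) => a b c d e.
  by clearbody m; clear; lra.
have minseq (n : nat) : exists x, M x /\ J x < m + n.+1%:R^-1.
  have [_ [y My <-] Jy] := @inf_adherent _ S n.+1%:R^-1 ltac:(by rewrite invr_gt0) hS.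
  by exists y.
have [x Hx] := choice minseq.
have [|u Hu] := @cauchy_seq_cvg _ H x.
  move=> e e0.
  have [N HN] := @inv_nat_lt R (e ^+ 2 / 4) ltac:(by rewrite divr_gt0 ?exprn_gt0).
  exists N => n k Nn Nk; rewrite -ltr_sqr ?nnegrE ?(ltW e0)//.
  apply: le_lt_trans (par _ _ (Hx n).1 (Hx k).1) _.
  have := (Hx n).2; have := (Hx k).2; have := HN _ Nn; have := HN _ Nk.
  move: (e ^+ 2) (n.+1%:R^-1) (k.+1%:R^-1) (J (x n)) (J (x k)) => a b c d f.
  by lra.
have Mu : M u.
  by apply: Mc => e e0; have [N HN] := Hu e e0; exists (x N); [case: (Hx N)|exact: HN].
(* With [d = |u - x n| < min e 1], the difference [J u - J (x n)] is at most
   [d (2 |u| + 1) + 2 |l| d], and [J (x n) < m + e]; this adds up to the constant below. *)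
have Jum : J u <= m.
  rewrite -subr_le0; apply: (@le0_small _ _ (2 + 2 * `|u| + 2 * `|l|)).
    by rewrite !addr_ge0 ?mulr_ge0.
  move=> e e0.
  have [N1 HN1] := Hu (Num.min e 1) ltac:(by rewrite lt_min e0 ltr01).
  have [N2 HN2] := inv_nat_lt e0.
  pose n := maxn N1 N2.
  have := HN1 n (leq_maxl _ _); have := HN2 n (leq_maxr _ _).
  have := (Hx n).2; rewrite lt_min => Jn ne /andP[ue u1].
  have lu : `|l u - l (x n)| <= `|l| * `|u - x n| by rewrite -blinB; exact: blin_normP.
  have lu' : (l u : R) - l (x n) >= - (`|l| * `|u - x n|).
    by rewrite lerNl; apply: le_trans lu; rewrite -normrN ler_norm.
  have nu : `|u| <= `|u - x n| + `|x n| by rewrite -{1}[u](subrK (x n)) ler_normD.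
  have nx : `|x n| <= `|u - x n| + `|u| by rewrite -{1}[x n](subrK u) distrC ler_normD.
  move: Jn; rewrite /J.
  have := normr_ge0 (u - x n); have := normr_ge0 u; have := normr_ge0 (x n).
  have := normr_ge0 l.
  move: lu' nu nx ue u1 ne.
  move: (`|u - x n|) (`|u|) (`|x n|) (`|l|) (l u : R) (l (x n) : R) (n.+1%:R^-1).
  generalize m => mm d a b L p q r lu' nu nx de d1 re L0 b0 a0 d0 Jn.
  have : a ^+ 2 - b ^+ 2 <= d * (2 * a + 1).
    have [ab|ba] := lerP a b; first by nra.
    have : (a - b) * (a + b) <= d * (2 * a + 1) by apply: ler_pM; lra.
    by lra.
  have : d * (2 * a + 1) <= e * (2 * a + 1) by rewrite ler_wpM2r//; lra.
  have : L * d <= L * e by rewrite ler_wpM2l//; lra.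
  by lra.
exists u => // y My.
apply/eqP; rewrite eq_sym -subr_eq0; apply/eqP.
(* Minimality of [u] along [u + t y] reads [0 <= t^2 |y|^2 + 2 t (ip u y - l y)] for every [t]. *)
apply: (quadratic_ge0_eq0 (sqr_ge0 `|y|)) => t.
have Mt : M (t *: y + u) by apply: Ml.
have := le_trans Jum (mJ _ Mt).
rewrite /J sqr_normD normrZ exprMn real_normK ?num_real// blinD blinZ ipZl (ipC y).
rewrite /GRing.scale/=.
move: (ip u y) (l y : R) (l u : R) (`|u| ^+ 2) (`|y| ^+ 2 ) => a b c d f.
by clear; lra.
Qed.


Lemma riesz H (l : 'L(H, R^o)) : exists u, forall x, l x = ip u x.
Proof.
by have [//|//|//|u _ Hu] := @riesz_subspace H setT l; exists u => x; exact: Hu.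
Qed.

Lemma ip_blin_ex H (x : H) : {l : 'L(H, R^o) | forall y, l y = ip x y}.
Proof.
apply: (@blin_ex _ _ R^o (fun y => ip x y) `|x|).
  by move=> a y z; rewrite ipDr ipZr.
by move=> y; exact: cauchy_schwarz.
Qed.

(** On the closure [M] of [S] the functional [ip x] is represented by some [u] in [M]. Then [x - u]
    is orthogonal to [S], so [x = u] lies in [M]. *)
Lemma dense_orthoP H (S : set H) :
  S 0 -> (forall a x y, S x -> S y -> S (a *: x + y)) ->
  (forall x, (forall y, S y -> ip x y = 0) -> x = 0) -> dense S.
Proof.
move=> S0 Sl So.
pose M x := forall e : R, 0 < e -> exists2 y, S y & `|x - y| < e.
have SM x : S x -> M x by move=> Sx e e0; exists x; rewrite ?subrr ?normr0.
suff MT x : M x by apply: norm_dense.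
have [l lE] := ip_blin_ex x.
have [||z Hz|u Mu Hu] := @riesz_subspace H M l.
- exact: SM.
- move=> a y z My Mz e e0; have a1 : 0 < `|a| + 1 by rewrite ltr_wpDl.
  have d0 : 0 < e / (`|a| + 1) by rewrite divr_gt0.
  have [y' Sy' yy] := My _ d0; have [z' Sz' zz] := Mz _ d0.
  exists (a *: y' + z'); first exact: Sl.
  rewrite opprD addrACA -scalerBr; apply: le_lt_trans (ler_normD _ _) _.
  rewrite normrZ.
  have -> : e = `|a| * (e / (`|a| + 1)) + e / (`|a| + 1).
    by rewrite -{2}[e / _]mul1r -mulrDl mulrC divfK// gt_eqF.
  by rewrite ler_ltD// ler_wpM2l// ltW.
- move=> e e0; have [y My xy] := Hz (e / 2) ltac:(by rewrite divr_gt0).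
  have [w Sw yw] := My (e / 2) ltac:(by rewrite divr_gt0); exists w => //.
  rewrite -[z](subrK y) -addrA; apply: le_lt_trans (ler_normD _ _) _; lra.
suff -> : x = u by [].
apply/eqP; rewrite -subr_eq0; apply/eqP; apply: So => y Sy.
by rewrite ipBl -Hu ?lE ?subrr//; exact: SM.
Qed.

Section Adjoint.
Variables X Y : hilbertType R.

(** Over the reals the adjoint is linear in the operator and of norm at most 1, so [adj] is itself a
    bounded linear map and can enter bilinear expressions. *)
Fact adj_ex : {A : 'L('L(X, Y), 'L(Y, X)) |
  forall f y x, ip (A f y) x = ip y (f x)}.
Proof.
have ex1 (f : 'L(X, Y)) (y : Y) : {z : X | forall x, ip z x = ip y (f x)}.
  have [l lE] := ip_blin_ex y; apply: cid.
  by have [u Hu] := riesz (bcomp l f); exists u => x; rewrite -Hu bcompE lE.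
pose a f y := sval (ex1 f y).
have aE f y x : ip (a f y) x = ip y (f x) by exact: svalP (ex1 f y) x.
have [||||A AE] := @blin2_ex _ _ _ _ a 1.
- by move=> f c y z; apply: ip_inj => x; rewrite !(ipC x) aE !(ipDl, ipZl) !aE.
- move=> y c f g; apply: ip_inj => x.
  by rewrite !(ipC x) aE blin_addE blin_scaleE !(ipDl, ipZl) !aE ipDr ipZr.
- exact: ler01.
- move=> f y; rewrite mul1r; apply: ip_sqrt_le; first by rewrite mulr_ge0.
  rewrite aE; apply: le_trans (ler_norm _) _; apply: le_trans (cauchy_schwarz _ _) _.
  by rewrite mulrC mulrAC ler_wpM2r// blin_normP.
by exists A => f y x; rewrite AE aE.
Qed.

Definition adj := sval adj_ex.

Lemma adjE f y x : ip (adj f y) x = ip y (f x).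
Proof. exact: svalP adj_ex f y x. Qed.

Lemma adjEr f y x : ip x (adj f y) = ip (f x) y.
Proof. by rewrite ipC adjE ipC. Qed.

(** A vector orthogonal to the range of the adjoint lies in the kernel of [f]. *)
Lemma dense_range_adj (f : 'L(X, Y)) : injective f -> dense (range (adj f)).
Proof.
move=> fi; apply: dense_orthoP.
- by exists 0 => //; rewrite blin0.
- move=> a _ _ [y _ <-] [z _ <-]; exists (a *: y + z) => //.
  by rewrite blinD blinZ.
- move=> x xf; apply: fi; rewrite blin0; apply: ip_inj => y.
  by rewrite ip0r ipC -adjEr xf//; exists y.
Qed.

(* Banach-Steinhaus bounds [{y | `|adj f y| <= 1}], i.e. [adj f] is bounded
   below; this dualises to [f]. *)
Lemma bijective_bounded_below (f : 'L(X, Y)) : bijective f ->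
  exists2 M : R, 0 < M & forall x, `|x| <= M * `|f x|.
Proof.
move=> [g fK gK].
have [M0 HM0] : exists M : R, forall y, `|adj f y| <= 1 -> `|y| <= M.
  pose F : set (Y -> R^o) := [set h | exists2 y, `|adj f y| <= 1 & h = ip y].
  have [h [y y1 ->]|z|M HM] := @Banach_Steinhauss R Y R^o F _ _ 1.
  - split.
      move=> r; exists (`|y| * r) => x xr; apply: le_trans (cauchy_schwarz _ _) _.
      by rewrite ler_wpM2l.
    by move=> a u v; rewrite ipDr ipZr.
  (* Pointwise boundedness comes from surjectivity: [ip y z = ip y (f (g z)) = ip (adj f y) (g
     z)]. *)
  - exists `|g z| => h [y y1 ->]; rewrite -{1}[z]gK -adjE.
    by apply: le_trans (cauchy_schwarz _ _) _; rewrite ler_piMl.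
  exists M => y y1; have [->|y0] := eqVneq y 0.
    by rewrite normr0; apply: le_trans (HM (ip 0) _ 0 _);
      rewrite ?normr0//; exists 0 => //; rewrite blin0 normr0.
  have n0 : `|y| != 0 by rewrite normr_eq0.
  have := HM (ip y) (ex_intro2 _ _ y y1 erefl) (`|y|^-1 *: y).
  rewrite normrZ normfV normr_id mulVf// lexx => /(_ isT).
  by rewrite ipZr -sqr_normE expr2 mulKf// normr_id.
pose M := `|M0| + 1; have Mp : 0 < M by rewrite ltr_wpDl.
exists M => // x.
have HM y : `|y| <= M * `|adj f y|.
  have [a0|a0] := eqVneq (adj f y) 0.
    have -> : y = 0.
      by apply: ip_inj => z; rewrite ip0r -[z]gK -adjEr a0 ip0r.
    by rewrite normr0 mulr_ge0// ltW.
  have n0 : 0 < `|adj f y| by rewrite normr_gt0.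
  have := HM0 (`|adj f y|^-1 *: y).
  rewrite blinZ !normrZ normfV normr_id mulVf ?gt_eqF// lexx => /(_ isT).
  rewrite ler_pdivrMl// mulrC => /le_trans; apply; rewrite ler_wpM2r//.
  by apply: le_trans (ler_norm _) _; rewrite lerDl.
apply: ip_sqrt_le; first by rewrite mulr_ge0// ltW.
have fi : injective f by apply: can_inj fK.
(* By density [x] is within [e] of some [adj f y], where [|y| <= M (|x| + e)] and
   [ip x (adj f y) = ip (f x) y]; letting [e] tend to 0 gives [|x|^2 <= M |f x| |x|]. *)
rewrite -subr_le0; apply: (@le0_small _ _ (`|x| + M * `|f x|)).
  by rewrite addr_ge0// mulr_ge0// ltW.
move=> e e0; have [_ [y _ <-] xy] := dense_norm (dense_range_adj fi) x e0.
have h1 : ip x (x - adj f y) <= `|x| * e.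
  apply: le_trans (ler_norm _) _; apply: le_trans (cauchy_schwarz _ _) _.
  by rewrite ler_wpM2l// ltW.
have h2 : ip x (adj f y) <= `|f x| * (M * (`|x| + e)).
  rewrite adjEr; apply: le_trans (ler_norm _) _; apply: le_trans (cauchy_schwarz _ _) _.
  rewrite ler_wpM2l//; apply: le_trans (HM y) _; rewrite ler_wpM2l ?ltW//.
  rewrite -[adj f y](subrK x) addrC; apply: le_lt_trans (ler_normD _ _) _.
  by rewrite distrC ltrD2l.
have -> : ip x x = ip x (x - adj f y) + ip x (adj f y) by rewrite ipBr subrK.
by move: h1 h2; move: (ip x (x - _)) (ip x (adj f y)) (`|x|) (`|f x|) => a b c d; lra.
Qed.

End Adjoint.

End Hilbert.

Arguments adj {R X Y}.

(** * Fredholm operators of index zero *)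

Section FiniteRank.
Context {R : realType}.
Implicit Types Y : normedModType R.

Definition lincomb n (Y : normedModType R) (w : 'I_n -> Y) (c : 'rV[R]_n) : Y :=
  \sum_(i < n) c 0 i *: w i.

Lemma lincomb_linear n Y (w : 'I_n -> Y) : linear (lincomb w).
Proof.
move=> a c d; rewrite /lincomb scaler_sumr -big_split/=; apply: eq_bigr => i _.
by rewrite !mxE scalerDl scalerA.
Qed.

Lemma lincombD n Y (w : 'I_n -> Y) c d :
  lincomb w (c + d) = lincomb w c + lincomb w d.
Proof. by rewrite -{1}[c]scale1r lincomb_linear scale1r. Qed.

Lemma lincomb0 n Y (w : 'I_n -> Y) : lincomb w 0 = 0.
Proof. by rewrite /lincomb big1// => i _; rewrite mxE scale0r. Qed.

Lemma lincombZ n Y (w : 'I_n -> Y) a c : lincomb w (a *: c) = a *: lincomb w c.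
Proof. by rewrite -{1}[a *: c]addr0 lincomb_linear lincomb0 addr0. Qed.

Lemma lincombN n Y (w : 'I_n -> Y) c : lincomb w (- c) = - lincomb w c.
Proof. by rewrite -scaleN1r lincombZ scaleN1r. Qed.

Lemma lincombB n Y (w : 'I_n -> Y) c d :
  lincomb w (c - d) = lincomb w c - lincomb w d.
Proof. by rewrite lincombD lincombN. Qed.

Lemma blin_lincomb n (X Y : normedModType R) (f : 'L(X, Y)) (w : 'I_n -> X) c :
  f (lincomb w c) = lincomb (f \o w) c.
Proof. by rewrite blin_sum; apply: eq_bigr => i _; rewrite blinZ. Qed.

Lemma lincomb_mulmx n k Y (w : 'I_n -> Y) (K : 'M[R]_(k, n)) c :
  lincomb w (c *m K) = lincomb (fun i => lincomb w (row i K)) c.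
Proof.
rewrite /lincomb; under [RHS]eq_bigr do rewrite scaler_sumr.
rewrite exchange_big/=; apply: eq_bigr => j _.
rewrite mxE scaler_suml; apply: eq_bigr => i _; by rewrite mxE scalerA.
Qed.

(** A factorization through [R^n], the form in which matrix algebra applies. *)
Definition finite_rank (X Y : normedModType R) (F : X -> Y) :=
  exists n (f : X -> 'rV[R]_n) (w : 'I_n -> Y),
    linear f /\ forall x, F x = lincomb w (f x).

Lemma finite_rankD (X Y : normedModType R) (F G : X -> Y) :
  finite_rank F -> finite_rank G -> finite_rank (fun x => F x + G x).
Proof.
move=> [n [f [w [fl fE]]]] [m [g [v [gl gE]]]].
exists (n + m)%N, (fun x => row_mx (f x) (g x)),
  (fun i => match fintype.split i with inl i => w i | inr i => v i end).
split=> [a x y|x]; first by rewrite fl gl scale_row_mx add_row_mx.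
rewrite fE gE /lincomb big_split_ord/=; congr (_ + _); apply: eq_bigr => i _.
  by rewrite row_mxEl (unsplitK (inl i)).
by rewrite row_mxEr (unsplitK (inr i)).
Qed.

Lemma finite_rank_ip (X Y : normedModType R) (Z : hilbertType R) n
    (v : 'I_n -> Z) (w : 'I_n -> Y) (g : 'L(X, Z)) :
  finite_rank (fun x => \sum_(i < n) ip (g x) (v i) *: w i).
Proof.
exists n, (fun x => \row_i ip (g x) (v i)), w; split=> [a x y|x].
  by apply/rowP => i; rewrite !mxE blinD blinZ ipDl ipZl.
by apply: eq_bigr => i _; rewrite mxE.
Qed.

(* With [B = 1] and [F = w \o f], kernel and cokernel of [1 + w \o f] are those
   of the matrix [1 + f \o w]. *)
Lemma fredholm_bijectiveD_finite_rank (X Y : normedModType R) (A B : 'L(X, Y))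
    (F : X -> Y) :
  bijective B -> finite_rank F -> (forall x, A x = B x + F x) ->
  fredholm_of_index A 0.
Proof.
move=> [g Bg gB] [r [f [w [fl fE]]]] AE.
have gl : linear g by move=> a x y; rewrite -[RHS]Bg blinD blinZ !gB.
pose u i := g (w i).
have BU c : B (lincomb u c) = lincomb w c.
  by rewrite blin_lincomb; apply: eq_bigr => i _ /=; rewrite gB.
have AB x : A x = B (x + lincomb u (f x)) by rewrite AE fE blinD BU.
pose fL : {linear X -> 'rV[R]_r} := HB.pack f (GRing.isLinear.Build _ _ _ _ _ fl).
have fD x y : f (x + y) = f x + f y by exact: (raddfD fL).
have fB x y : f (x - y) = f x - f y by exact: (raddfB fL).
have fZ a x : f (a *: x) = a *: f x
  by rewrite -[a *: x]addr0 fl -[in f 0](subrr 0) fB subrr addr0.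
have fN x : f (- x) = - f x by exact: (raddfN fL).
(* Row vectors are multiplied on the right: [M] is the matrix of [c |-> c + f (lincomb u c)]. *)
pose M : 'M[R]_r := 1%:M + \matrix_i f (u i).
have ME c : c *m M = c + f (lincomb u c).
  rewrite mulmxDr mulmx1; congr (_ + _).
  rewrite mulmx_sum_row /lincomb -[f]/(fL : _ -> _) raddf_sum; apply: eq_bigr => i _.
  rewrite rowK; exact/esym/fZ.
(* Bases of the kernel of [M] and of a complement of its row space. Both have [r - \rank M] rows,
   whence index zero. *)
pose K := row_base (kermx M); pose C := row_base (M^C)%MS.
have KM c : c *m K *m M = 0.
  apply/eqP; rewrite -sub_kermx; apply: submx_trans (submxMl _ _) _.
  by rewrite eq_row_base.
have fUK c : f (lincomb u (c *m K)) = - (c *m K).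
  by apply/eqP; rewrite -addr_eq0 addrC -ME KM.
have Kinj c c' : c *m K = c' *m K -> c = c'.
  by apply: row_free_inj; exact: row_base_free.
exists (\rank (kermx M)), (\rank (M^C)%MS); split; last first.
  by rewrite mxrank_ker mxrank_compl subrr.
- exists (fun i => lincomb (fun i => B (u i)) (row i C)) => y.
  have CE (c : 'rV_(\rank (M^C)%MS)) :
      \sum_(i < \rank (M^C)%MS) c 0 i *: lincomb (fun i => B (u i)) (row i C) =
      B (lincomb u (c *m C)).
    rewrite -[LHS]/(lincomb _ c) lincomb_mulmx blin_lincomb; apply: eq_bigr => i _ /=.
    by rewrite blin_lincomb.
  have /sub_addsmxP[[d a] /= fyE] : (f (g y) <= M + M^C)%MS.
    by apply: submx_full; exact: addsmx_compl_full.
  have /submxP[c cE] : (a *m (M^C)%MS <= C)%MS.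
    by rewrite eq_row_base submxMl.
  (* Modulo the row space of [M], [f (g y)] equals [- (c' *m C)]. So the component of [f (g y)] in
     the complement determines [c'], and the witness is [- c]. *)
  have key x c' : y = A x + B (lincomb u (c' *m C)) ->
      f (g y) = (f x + c' *m C) *m M - c' *m C.
    by move=> ->; rewrite AB -blinD Bg !fD ME lincombD fD [RHS]addrAC addrK addrA.
  exists (- c); split.
    exists (g y - lincomb u d); rewrite CE mulNmx lincombN -cE AB -blinD -[LHS]gB.
    have -> : f (g y - lincomb u d) = d + a *m (M^C)%MS.
      by rewrite fB fyE ME addrAC addrK.
    by rewrite lincombD addrA subrK addrK.
  move=> c' [x]; rewrite CE => /key; rewrite fyE cE.
  set T := f x + _ => E.
  have {}E : (c + c') *m C = (T - d) *m M.
    by rewrite mulmxDl -[c *m C](addKr (d *m M)) E addrA subrK addrC mulmxBl.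
  have /eqP : (c + c') *m C = 0.
    apply/eqP; rewrite -submx0 -(capmx_compl M) sub_capmx; apply/andP; split.
      by rewrite E submxMl.
    by apply: submx_trans (submxMl _ _) _; rewrite eq_row_base.
  rewrite -(mul0mx _ C) => /eqP/(row_free_inj (row_base_free _)) /eqP.
  by rewrite addr_eq0 => /eqP ->; rewrite opprK.
(* [A x = 0] means [x = - lincomb u (f x)], and then [f x] lies in the kernel of [M]. *)
- exists (fun i => - lincomb u (row i K)) => x.
  have KE (c : 'rV_(\rank (kermx M))) :
      \sum_(i < \rank (kermx M)) c 0 i *: - lincomb u (row i K) =
      - lincomb u (c *m K).
    rewrite lincomb_mulmx -sumrN; apply: eq_bigr => i _; by rewrite scalerN.
  split=> [|[c [-> _]]]; last first.
    by rewrite KE AB fN fUK opprK addNr blin0.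
  move=> /(congr1 g); rewrite AB Bg -[in RHS](blin0 B) Bg => xE.
  have fxM : f x *m M = 0 by rewrite ME -fD xE -[0](subrr 0) fB subrr.
  have /submxP[c cE] : (f x <= K)%MS by rewrite eq_row_base sub_kermx fxM.
  exists c; split=> [|c']; rewrite KE.
    by apply/eqP; rewrite -addr_eq0 -cE xE.
  by move=> xE'; apply: Kinj; rewrite -cE xE' fN fUK opprK.
Qed.


Lemma finite_rank_blin_ex (X Y : hilbertType R) n (v : 'I_n -> X) (w : 'I_n -> Y) :
  {F : 'L(X, Y) | forall x, F x = \sum_(i < n) ip x (v i) *: w i}.
Proof.
apply: (@blin_ex _ _ _ _ (\sum_(i < n) `|v i| * `|w i|)) => [a x y|x].
  rewrite scaler_sumr -big_split/=; apply: eq_bigr => i _.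
  by rewrite ipDl ipZl scalerDl scalerA.
apply: le_trans (ler_norm_sum _ _ _) _; rewrite mulr_suml; apply: ler_sum => i _.
by rewrite normrZ mulrAC ler_wpM2r// mulrC cauchy_schwarz.
Qed.

(** If the Gram matrix kills [c], then [lincomb v c] is orthogonal to every [v j], hence to
    itself. *)
Lemma gram_unitmx (X : hilbertType R) n (v : 'I_n -> X) :
  (forall c, lincomb v c = 0 -> c = 0) -> (\matrix_(i, j) ip (v i) (v j)) \in unitmx.
Proof.
set G := \matrix_(_, _) _ => vf.
have key (c : 'rV_n) : c *m G = 0 -> c = 0.
  move=> cG; apply/vf/eqP; rewrite -normr_eq0 -sqrf_eq0 sqr_normE {2}/lincomb.
  rewrite ip_sumr big1// => j _; rewrite ipZr.
  have -> : ip (lincomb v c) (v j) = 0; last by rewrite mulr0.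
  rewrite /lincomb ip_suml; have /rowP/(_ j) := cG; rewrite !mxE => E.
  by rewrite -[RHS]E; apply: eq_bigr => k _; rewrite mxE ipZl.
rewrite -row_free_unit -kermx_eq0; apply/eqP/row_matrixP => i.
by rewrite row0; apply/key/eqP; rewrite -sub_kermx row_sub.
Qed.

(** Index zero gives a kernel basis [v] and a complement basis [w] of the same length. The map
    [F x = sum_i (ip x (v i)) w i] sends the kernel isomorphically onto the complement, since the
    Gram matrix of [v] is invertible, and [B = A + F] is bijective. *)
Lemma fredholm0_correction (X Y : hilbertType R) (A : 'L(X, Y)) :
  fredholm_of_index A 0 -> exists (B : 'L(X, Y)) n (v : 'I_n -> X) (w : 'I_n -> Y),
    bijective B /\ forall x, A x = B x - \sum_(i < n) ip x (v i) *: w i.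
Proof.
move=> [n [m [[v vP] [w wP] nm]]].
have {}nm : n = m by apply/eqP; rewrite -eqz_nat -subr_eq0 -nm.
move: w wP; rewrite -nm => w wP.
have [F FE] := finite_rank_blin_ex v w.
(* Independence of [v] is the uniqueness of the coefficients of the kernel vector 0. *)
have vfree c : lincomb v c = 0 -> c = 0.
  move=> c0; have /vP[d [_ dU]] : A 0 = 0 by rewrite blin0.
  by rewrite -(dU c) ?c0// -(dU 0)// [RHS]lincomb0.
have GU := gram_unitmx vfree.
pose r (x : X) : 'rV[R]_n := \row_i ip x (v i).
have FE' x : F x = lincomb w (r x).
  by rewrite FE; apply: eq_bigr => i _; rewrite mxE.
have rD x a : r (x + lincomb v a) = r x + a *m \matrix_(i, j) ip (v i) (v j).
  apply/rowP => j; rewrite !mxE ipDl; congr (_ + _); rewrite ip_suml.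
  by apply: eq_bigr => i _; rewrite ipZl mxE.
have wU x c x' c' : A x + lincomb w c = A x' + lincomb w c' -> c = c'.
  move=> E; have [d [_ dU]] := wP (A x + lincomb w c).
  by rewrite -(dU c); [rewrite -(dU c')//; exists x'|exists x].
exists (A + F), n, v, w; split=> [|x]; last by rewrite blin_addE -FE addrK.
have inj x : (A + F) x = 0 -> x = 0.
  rewrite blin_addE FE' => E.
  have r0 : r x = 0 by apply: (wU x _ 0); rewrite E blin0 lincomb0 addr0.
  have /vP[c [xE _]] : A x = 0 by rewrite -E r0 lincomb0 addr0.
  apply/eqP; rewrite -normr_eq0 -sqrf_eq0 sqr_normE {2}xE ip_sumr big1// => i _.
  by have /rowP/(_ i) := r0; rewrite ipZr !mxE => ->; rewrite mulr0.
have surj y : exists x, (A + F) x = y.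
  have [c [[x yE] _]] := wP y.
  (* Adding the kernel vector [lincomb v a] to [x] keeps [A x] and changes [r x] into [c]. *)
  pose a := (c - r x) *m invmx (\matrix_(i, j) ip (v i) (v j)).
  exists (x + lincomb v a); rewrite blin_addE FE' blinD yE.
  have -> : A (lincomb v a) = 0.
    apply/vP; exists a; split=> // d /eqP; rewrite -subr_eq0 -[X in _ - X]/(lincomb v d).
    by rewrite -lincombB => /eqP/vfree/eqP; rewrite subr_eq0 => /eqP.
  rewrite addr0; congr (_ + lincomb _ _).
  by rewrite rD mulmxKV// addrC subrK.
have [g gP] := choice surj; exists g => // x.
by apply/eqP; rewrite -subr_eq0; apply/eqP/inj; rewrite blinB gP subrr.
Qed.

(** Solutions of [B x + E x = y] are the fixed points of [x |-> g (y - E x)], a contraction of ratio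
    [M |E|]. *)
Lemma bijective_small_perturbation (X Y : hilbertType R) (B E : 'L(X, Y)) (M : R) :
  bijective B -> (forall x, `|x| <= M * `|B x|) -> 0 < M -> M * `|E| < 1 ->
  bijective (B + E).
Proof.
move=> [g Bg gB] BM M0 ME1.
have key x x' : `|g (E x) - g (E x')| <= M * `|E| * `|x - x'|.
  apply: le_trans (BM _) _; rewrite blinB !gB -blinB -mulrA ler_wpM2l ?(ltW M0)//.
  exact: blin_normP.
have gD y z : g (y - z) = g y - g z by rewrite -[RHS]Bg blinB !gB.
have inj x : (B + E) x = 0 -> x = 0.
  rewrite blin_addE => /eqP; rewrite addr_eq0 => /eqP BE.
  have := BM x; rewrite BE normrN => xE; apply/eqP; rewrite -normr_le0.
  have := blin_normP E x; move: (normr_ge0 x) xE M0 ME1.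
  move: (`|x|) (`|E|) (`|E x|) => a b c; nra.
have surj y : exists x, (B + E) x = y.
  pose T x := g (y - E x).
  have TT : set_fun setT setT T by [].
  pose Tf : {fun [set: X] >-> [set: X]} := HB.pack T (isFun.Build _ _ _ _ T TT).
  have q0 : 0 <= M * `|E| by rewrite mulr_ge0// ltW.
  have ctr : is_contraction Tf.
    exists (NngNum q0); split=> // -[x x'] _ /=.
    by rewrite /T !gD opprB addrC addrA addrNK distrC; exact: key.
  have [//||p _ pE] := banach_fixed_point ctr; first by exists 0.
  exists p; rewrite blin_addE {1}pE /= gB subrK//.
have [h hP] := choice surj; exists h => // x.
by apply/eqP; rewrite -subr_eq0; apply/eqP/inj; rewrite blinB hP subrr.
Qed.


(** * Compact operators through finite nets, and their finite rank approximation *)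

Definition totally_bounded_op (X Y : normedModType R) (K : 'L(X, Y)) :=
  forall e : R, 0 < e -> exists s : seq Y,
    forall x, `|x| <= 1 -> exists2 z, z \in s & `|K x - z| <= e.

Lemma compact_totally_bounded (X Y : normedModType R) (K : 'L(X, Y)) :
  (forall B : set X, bounded_set B -> precompact (K @` B)) -> totally_bounded_op K.
Proof.
move=> Kc e e0; pose B : set X := [set x | `|x| <= 1].
have /Kc : bounded_set B.
  by exists 1; split=> [|M M1 x /= x1]; [exact: num_real|exact: le_trans x1 (ltW M1)].
rewrite precompactE compact_cover => /(_ Y (K @` B) (fun z => ball z e)).
case=> [z _||D _ cD]; first exact: ball_open.
  move=> z /(_ (ball z e)) []; first exact: nbhsx_ballx.
  by move=> w [Bw zw]; exists w => //; exact: ball_sym.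
exists (finmap.enum_fset D) => x x1.
have [] := cD (K x); first by apply: subset_closure; exists x.
move=> z zD; rewrite -ball_normE/= => xz; exists z => //.
by rewrite distrC ltW.
Qed.

(** A fine net for [i] on the unit ball is pulled back to points of that ball, whose images under
    [K] form a net: a difference of two unit vectors has norm at most 2, and it is small under
    [i]. *)
Lemma totally_bounded_ehrling (X Y Z : normedModType R) (i : 'L(X, Y)) (K : 'L(X, Z)) :
  totally_bounded_op i ->
  (forall e : R, 0 < e -> exists C, forall x, `|K x| <= e * `|x| + C * `|i x|) ->
  totally_bounded_op K.
Proof.
move=> ic Ki e e0.
(* The two terms contribute [e / 4 * 2] and [D * (e / (2 * D))], that is [e / 2] each; [D] replaces
   [C] to have a positive constant. *)
have [C HC] := Ki (e / 4) ltac:(by rewrite divr_gt0).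
pose D := `|C| + 1; have D0 : 0 < D by rewrite ltr_wpDl.
have [s Hs] := ic (e / (4 * D)) ltac:(by rewrite divr_gt0// mulr_gt0).
pose P z x := `|x| <= 1 /\ `|i x - z| <= e / (4 * D).
(* A point of the unit ball sent near [z]; the default 0 is taken when there is none. *)
pose c z : X := if pselect (exists x, P z x) is left h then sval (cid h) else 0.
exists [seq K (c z) | z <- s] => x x1.
have [z zs xz] := Hs x x1; exists (K (c z)); first exact: map_f.
have [c1 cz] : P z (c z).
  rewrite /c; case: pselect => [h|]; first exact: svalP (cid h).
  by case; exists x.
rewrite -blinB; apply: le_trans (HC _) _.
have h1 : `|x - c z| <= 2.
  by apply: le_trans (ler_normB _ _) _; rewrite (_ : 2 = 1 + 1)// lerD.
have h2 : `|i (x - c z)| <= e / (2 * D).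
  rewrite blinB -[i x](subrK z) -addrA; apply: le_trans (ler_normD _ _) _.
  rewrite (distrC z) (_ : e / (2 * D) = e / (4 * D) + e / (4 * D)) ?lerD//.
  by field; rewrite gt_eqF.
have h3 : C * `|i (x - c z)| <= D * (e / (2 * D)).
  apply: (@le_trans _ _ (D * `|i (x - c z)|)); last by rewrite ler_wpM2l// ltW.
  by rewrite ler_wpM2r//; apply: le_trans (ler_norm _) _; rewrite lerDl.
have h4 : D * (e / (2 * D)) = e / 2 by field; rewrite gt_eqF.
rewrite h4 in h3.
by move: h1 h3 e0; move: (`|x - c z|) (C * _) => a b; clear; nra.
Qed.

(** Gram-Schmidt: a vector is adjoined, after projection and normalisation, only if its residual [d]
    is nonzero. *)
Lemma orthonormal_ex (Y : hilbertType R) (s : seq Y) :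
  exists n (e : 'I_n -> Y), (forall i j, ip (e i) (e j) = (i == j)%:R) /\
    forall z, z \in s -> z = \sum_(i < n) ip z (e i) *: e i.
Proof.
elim: s => [|z s [n [e [eo es]]]].
  by exists 0%N, (fun=> 0); split=> // -[].
pose p := \sum_(i < n) ip z (e i) *: e i; pose d := z - p.
have de i : ip d (e i) = 0.
  rewrite ipBl ip_suml (bigD1 i)//= big1 => [|j ji]; rewrite ipZl eo.
    by rewrite eqxx mulr1 addr0 subrr.
  by rewrite (negPf ji) mulr0.
have [d0|d0] := eqVneq d 0.
  exists n, e; split=> // w; rewrite inE => /orP[/eqP ->|]; last exact: es.
  by apply/eqP; rewrite -subr_eq0 -/p -/d d0.
have n0 : `|d| != 0 by rewrite normr_eq0.
pose e' (i : 'I_(n + 1)) :=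
  match fintype.split i with inl i => e i | inr _ => `|d|^-1 *: d end.
exists (n + 1)%N, e'; split.
  move=> i j; rewrite -[i]splitK -[j]splitK /e' !unsplitK.
  case: (fintype.split i) => {}i; case: (fintype.split j) => {}j /=.
  - by rewrite eo (inj_eq (@lshift_inj _ _)).
  - by rewrite ipZr ipC de mulr0 eq_lrshift.
  - by rewrite ipZl de mulr0 eq_rlshift.
  - rewrite ipZl ipZr -sqr_normE !ord1 eqxx expr2 mulKf// mulVf//.
have sumE w : \sum_(i < n + 1) ip w (e' i) *: e' i =
    \sum_(i < n) ip w (e i) *: e i + ip w d / `|d| ^+ 2 *: d.
  rewrite big_split_ord/= big_ord1; congr (_ + _).
    by apply: eq_bigr => i _; rewrite /e' (unsplitK (inl i)).
  rewrite /e' (unsplitK (inr ord0)) ipZr scalerA; congr (_ *: _).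
  by rewrite expr2 invfM; ring.
move=> w; rewrite inE sumE => /orP[/eqP ->|/es ws].
  have -> : ip z d = `|d| ^+ 2.
    rewrite sqr_normE {2}/d ipBl -[X in _ = _ - X](_ : 0 = _) ?subr0//.
    by rewrite /p ip_suml big1// => i _; rewrite ipZl (ipC (e i)) de mulr0.
  by rewrite mulfV ?expf_neq0// scale1r -/p addrC subrK.
have -> : ip w d = 0.
  by rewrite {1}ws ip_suml big1// => i _; rewrite ipZl (ipC (e i)) de mulr0.
by rewrite mul0r scale0r addr0 -ws.
Qed.

(** Pythagoras: [x - p] is orthogonal to the span, which contains [p - z]. *)
Lemma bessel_approx (Y : hilbertType R) n (e : 'I_n -> Y) :
  (forall i j, ip (e i) (e j) = (i == j)%:R) ->
  forall (x z : Y), z = \sum_(i < n) ip z (e i) *: e i ->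
  `|x - \sum_(i < n) ip x (e i) *: e i| <= `|x - z|.
Proof.
move=> eo x z ->; set p := \sum_(i < n) _; set q := \sum_(i < n) _.
have pe i : ip (x - p) (e i) = 0.
  rewrite ipBl ip_suml (bigD1 i)//= big1 => [|j ji]; rewrite ipZl eo.
    by rewrite eqxx mulr1 addr0 subrr.
  by rewrite (negPf ji) mulr0.
have pq : ip (x - p) (p - q) = 0.
  rewrite ipBr {2}/p /q !ip_sumr !big1 ?subrr// => i _; by rewrite ipZr pe mulr0.
have -> : x - q = (x - p) + (p - q) by rewrite addrA subrK.
rewrite -ler_sqr ?nnegrE// [leRHS]sqr_normD pq mulr0 addr0.
by rewrite lerDl sqr_ge0.
Qed.

(** The finite rank part is [K] followed by the orthogonal projection onto the span of an [e]-net;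
    best approximation bounds the remainder by the distance to the net. *)
Lemma totally_bounded_finite_rank (X Y : hilbertType R) (K : 'L(X, Y)) (e : R) :
  totally_bounded_op K -> 0 < e -> exists (E : 'L(X, Y)) n (v : 'I_n -> X) (w : 'I_n -> Y),
    `|E| <= e /\ forall x, K x = E x + \sum_(i < n) ip x (v i) *: w i.
Proof.
move=> Kc e0; have [s Hs] := Kc _ e0; have [n [w [wo ws]]] := orthonormal_ex s.
pose v i := adj K (w i); have [F FE] := finite_rank_blin_ex v w.
exists (K - F), n, v, w; split; last first.
  by move=> x; rewrite -FE -blin_addE subrK.
rewrite blin_normE; apply: opnorm_le => x x1; have [z zs xz] := Hs x x1.
apply: le_trans xz; have -> : (K - F) x = K x - F x by [].
rewrite FE; under eq_bigr do rewrite adjEr.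
exact/(bessel_approx wo)/ws.
Qed.

(** Write [A] as a bijection [B] minus finite rank and [K] as [E] plus finite rank, with [E] small
    against the lower bound of [S = P B Q]. Then [C] is the bijection [S + E] plus finite rank. *)
Lemma fredholm0_compact_perturbation (X Y : hilbertType R) (A C K : 'L(X, Y))
    (P : 'L(Y, Y)) (Q : 'L(X, X)) :
  fredholm_of_index A 0 -> bijective P -> bijective Q -> totally_bounded_op K ->
  (forall x, C x = P (A (Q x)) + K x) -> fredholm_of_index C 0.
Proof.
move=> /fredholm0_correction[B [n [v [w [Bb AE]]]]] Pb Qb Kc CE.
pose S := bcomp P (bcomp B Q).
have SE x : S x = P (B (Q x)) by rewrite !bcompE.
have Sb : bijective S.
  apply: (@eq_bij _ _ (P \o (B \o Q))) => [|x]; last by rewrite SE.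
  by apply: bij_comp => //; exact: bij_comp.
have [M M0 SM] := bijective_bounded_below Sb.
have [E [m [a [b [Ee KE]]]]] :=
  totally_bounded_finite_rank Kc (ltac:(by rewrite divr_gt0 ?invr_gt0) : 0 < M^-1 / 2).
have SEb : bijective (S + E).
  apply: (bijective_small_perturbation Sb SM M0).
  apply: (@le_lt_trans _ _ (M * (M^-1 / 2))); first by rewrite ler_wpM2l// ltW.
  by rewrite mulrA mulfV ?gt_eqF//; lra.
apply: (@fredholm_bijectiveD_finite_rank _ _ C (S + E)
  (fun x => \sum_(i < n) ip (Q x) (v i) *: - P (w i) +
            \sum_(i < m) ip (bid X x) (a i) *: b i)) => //.
  by apply: finite_rankD; exact: finite_rank_ip.
move=> x; rewrite CE AE KE blin_addE SE blinB blin_sum bidE.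
under eq_bigr do rewrite blinZ.
under [in RHS]eq_bigr do rewrite scalerN.
by rewrite sumrN addrACA [- _ + _]addrC !addrA.
Qed.

End FiniteRank.

(** * Interpolation spaces *)

Section OrthonormalBasis.
Context {R : realType} (X : hilbertType R) (I : choiceType) (b : I -> X).
Hypothesis b_ortho : forall k k', ip (b k) (b k') = (k == k')%:R.
Hypothesis b_complete : forall x, (forall k, ip x (b k) = 0) -> x = 0.

(** Lists stand for finite index sets; [undup] keeps a repeated index from counting twice. *)
Definition oproj (s : seq I) (x : X) := \sum_(k <- undup s) ip x (b k) *: b k.

Let oproj_linear s : linear (oproj s).
Proof.
move=> a x y; rewrite /oproj scaler_sumr -big_split/=; apply: eq_bigr => k _.
by rewrite ipDl ipZl scalerDl scalerA.
Qed.

Let oprojB s x y : oproj s (x - y) = oproj s x - oproj s y.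
Proof. by rewrite addrC -scaleN1r oproj_linear scaleN1r addrC. Qed.

Let ip_oproj s x k : ip (oproj s x) (b k) = (k \in s)%:R * ip x (b k).
Proof.
rewrite /oproj ip_suml; have [ks|ks] := boolP (k \in s); last first.
  rewrite mul0r big_seq big1// => j; rewrite mem_undup => js.
  by rewrite ipZl b_ortho; case: eqP ks => [<-|]; rewrite ?js ?mulr0.
rewrite (bigD1_seq k) ?undup_uniq ?mem_undup//= big1 => [|j jk].
  by rewrite ipZl b_ortho eqxx mulr1 addr0 mul1r.
by rewrite ipZl b_ortho (negPf jk) mulr0.
Qed.

Let oproj_sub s t x : {subset s <= t} -> oproj s x = x -> oproj t x = x.
Proof.
move=> st xs; apply/eqP; rewrite -subr_eq0; apply/eqP/b_complete => k.
rewrite ipBl ip_oproj; have [kt|kt] := boolP (k \in t).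
  by rewrite mul1r subrr.
rewrite -xs !ip_oproj; have [/st|_] := boolP (k \in s); first by rewrite (negPf kt).
by rewrite !mul0r subr0.
Qed.

Let ortho_oproj s x y : ip (x - oproj s x) (oproj s y) = 0.
Proof.
rewrite {2}/oproj ip_sumr big_seq big1// => k; rewrite mem_undup => ks.
by rewrite ipZr ipBl ip_oproj ks mul1r subrr mulr0.
Qed.

Let sqr_norm_oproj s x : `|oproj s x| ^+ 2 = \sum_(k <- undup s) ip x (b k) ^+ 2.
Proof.
rewrite sqr_normE {2}/oproj ip_sumr [LHS]big_seq [RHS]big_seq; apply: eq_bigr => k.
by rewrite mem_undup => ks; rewrite ipZr ip_oproj ks mul1r expr2.
Qed.

Let finite_span := [set x | exists s, oproj s x = x].

Let dense_finite_span : dense finite_span.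
Proof.
apply: dense_orthoP.
- by exists [::]; rewrite /oproj big_nil.
- move=> a x y [s xs] [t yt]; exists (s ++ t); rewrite oproj_linear.
  rewrite (oproj_sub _ xs) ?(oproj_sub _ yt)// => k ks; rewrite mem_cat ks ?orbT//.
- move=> x xb; apply: b_complete => k; apply: xb; exists [:: k].
  by rewrite /oproj /= big_seq1 b_ortho eqxx scale1r.
Qed.

(** On finitely many coordinates the comparison is termwise; Bessel's inequality for [x] and density
    of the finite span for [w] pass to the limit. *)
Lemma basis_dominated_norm (x w : X) :
  (forall k, `|ip w (b k)| <= `|ip x (b k)|) -> `|w| <= `|x|.
Proof.
move=> wx; rewrite -subr_le0; apply: (@le0_small _ _ 1) => // e e0; rewrite mul1r.
have [z [s zs] wz] := dense_norm dense_finite_span w e0.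
have h1 : `|w - oproj s w| <= `|w - z|.
  have -> : w - z = (w - oproj s w) + oproj s (w - z).
    by rewrite oprojB zs addrA subrK.
  rewrite -ler_sqr ?nnegrE// [leRHS]sqr_normD ortho_oproj mulr0 addr0.
  by rewrite lerDl sqr_ge0.
have h2 : `|oproj s w| <= `|oproj s x|.
  rewrite -ler_sqr ?nnegrE// !sqr_norm_oproj; apply: ler_sum => k _.
  rewrite -[leLHS]real_normK ?num_real// -[leRHS]real_normK ?num_real//.
  by rewrite ler_sqr ?nnegrE.
have h3 : `|oproj s x| <= `|x|.
  rewrite -ler_sqr ?nnegrE// -[in leRHS](subrK (oproj s x) x).
  by rewrite sqr_normD ortho_oproj mulr0 addr0 lerDr sqr_ge0.
have : `|w| <= `|w - oproj s w| + `|oproj s w|.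
  by rewrite -{1}[w](subrK (oproj s w)) ler_normD.
by move: h1 h2 h3 wz; move: (`|w - _|) (`|oproj s w|) (`|w|) => a c d; lra.
Qed.

(* The Fourier multiplier [m] as the closure of its graph. *)
Lemma multiplier_ex (m : I -> R) : (forall k, `|m k| <= 1) ->
  exists K : X -> X, forall x k, ip (K x) (b k) = m k * ip x (b k).
Proof.
move=> m1; pose G x w := forall k, ip w (b k) = m k * ip x (b k).
have Gl a x y z w : G x z -> G y w -> G (a *: x + y) (a *: z + w).
  by move=> xz yw k; rewrite !(ipDl, ipZl) xz yw; ring.
have Gb x w : G x w -> `|w| <= 1 * `|x|.
  move=> xw; rewrite mul1r; apply: basis_dominated_norm => k.
  by rewrite xw normrM ler_piMl.
have Gd : dense [set x | exists w, G x w].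
  apply: dense_orthoP.
  - by exists 0 => k; rewrite !ip0l mulr0.
  - by move=> a x y [z xz] [w yw]; exists (a *: z + w); exact: Gl.
  - move=> x xG; apply: b_complete => k; apply: xG; exists (m k *: b k) => j.
    by rewrite ipZl b_ortho; case: eqP => [->//|_]; rewrite !mulr0.
have [||||K KG _] := @graph_extension _ X X G 1 => //.
  by move=> x e e0; have [y yG xy] := dense_norm Gd x e0; exists y.
exists K => x k; have [l lE] := ip_blin_ex (b k).
(* For fixed [k] both sides are bounded functionals of [x], and they agree on the dense domain of
   the graph. *)
suff: bcomp l K = m k *: l.
  move=> /(congr1 (fun f : 'L(X, R^o) => f x)).
  by rewrite bcompE blin_scaleE !lE !(ipC (b k)).
apply: (eq_blin_dense Gd) => y [w yw].
by rewrite bcompE blin_scaleE !lE !(ipC (b k)) (KG _ _ yw) yw.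
Qed.

End OrthonormalBasis.

(** Beyond [t = e^(-1/(1-s))] one has [l^(1-s) >= 1/e], so [l^s <= e l]; below it, [l^s <= t^s]. A
    positive [C] later serves in a denominator. *)
Lemma powR_le_affine (R : realType) (s e : R) : 0 <= s < 1 -> 0 < e ->
  exists2 C : R, 0 < C & forall l, 0 <= l -> l `^ s <= e * l + C.
Proof.
move=> /andP[s0 s1] e0; have s10 : 1 - s != 0 by rewrite subr_eq0 gt_eqF.
pose t := e^-1 `^ (1 - s)^-1.
have t0 : 0 <= t by exact: powR_ge0.
exists (t `^ s + 1) => [|l l0]; first by rewrite ltr_wpDl// powR_ge0.
have [lt|tl] := lerP l t.
  have : l `^ s <= t `^ s by apply: ge0_ler_powR; rewrite ?nnegrE.
  have : 0 <= e * l by rewrite mulr_ge0// ltW.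
  lra.
have : l = l `^ s * l `^ (1 - s).
  rewrite -powRD; first by rewrite addrC subrK powRr1.
  by apply/implyP => _; rewrite gt_eqF// (le_lt_trans t0).
have : e^-1 <= l `^ (1 - s).
  have -> : e^-1 = t `^ (1 - s).
    by rewrite /t -powRrM mulVf// powRr1// invr_ge0 ltW.
  apply: ge0_ler_powR; rewrite ?nnegrE// ltW//.
  by rewrite subr_gt0.
rewrite -(ler_pM2l e0) mulfV ?gt_eqF//.
have := powR_ge0 l s; have := powR_ge0 t s.
move: (l `^ s) (l `^ (1 - s)) (t `^ s) => p q r r0 p0 eq1 ->.
have : p * 1 <= p * (e * q) by rewrite ler_wpM2l.
lra.
Qed.

Section Interpolation.
Context {R : realType} (Y X : hilbertType R) (i : 'L(Y, X)) (s : R).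
Variable Z : interp_space i s.
Hypothesis s01 : 0 <= s < 1.

Let L := interp_op Z.

(** The vector 0 lies in the interpolation space, so [interp_dom] provides a fractional power of it,
    which carries an eigenbasis. *)
Let eigenbasis_ex : exists (I : choiceType) (e : I -> Y) (l : I -> R),
  eigenbasis i L e l.
Proof.
have [w [I [e [l [el _]]]]] : exists w, frac_pow i L s 0 w.
  by apply/(interp_dom Z); exists 0; rewrite raddf0.
by exists I, e, l.
Qed.

(** [L^s] applied to [i y] is the multiplier [l^s / (e l + C)], bounded by 1, applied to
    [e L y + C i y]; and [|L y| = |y|]. *)
Let frac_pow_ex (e : R) : 0 < e -> exists2 C : R, 0 <= C & forall y,
  exists2 w, frac_pow i L s (i y) w & `|w| <= e * `|y| + C * `|i y|.
Proof.
move=> e0; have [I [u [l ul]]] := eigenbasis_ex; have [Lu uo uc] := ul.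
have [C C0 HC] := powR_le_affine s01 e0.
have [Lsa Lpos] := interp_op_sa Z.
have l0 k : 0 <= l k.
  by have := Lpos (u k); rewrite Lu ipZl uo eqxx mulr1.
have Lsym y k : ip (L y) (i (u k)) = l k * ip (i y) (i (u k)).
  by rewrite -ipZr -Lu; apply: (Lsa _ _).2; exists (u k).
have d0 k : 0 < e * l k + C by rewrite ltr_wpDl// mulr_ge0// ltW.
pose m k := l k `^ s / (e * l k + C).
have m1 k : `|m k| <= 1.
  by rewrite ger0_norm ?divr_ge0 ?powR_ge0 ?(ltW (d0 k))// ler_pdivrMr// mul1r HC.
have [K KE] := multiplier_ex uo uc m1.
exists C => [|y]; first exact: ltW.
pose v := e *: L y + C *: i y.
have vE k : ip v (i (u k)) = (e * l k + C) * ip (i y) (i (u k)).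
  by rewrite ipDl !ipZl Lsym; ring.
exists (K v).
  exists I, u, l; split=> // k.
  by rewrite KE vE mulrA /m divfK// gt_eqF.
have -> : e * `|y| = `|e *: L y|.
  by rewrite normrZ (interp_op_norm Z) gtr0_norm.
have -> : C * `|i y| = `|C *: i y| by rewrite normrZ gtr0_norm.
apply: le_trans (ler_normD _ _); apply: (basis_dominated_norm uo uc) => k.
by rewrite KE normrM ler_piMl.
Qed.

Let interp_incl_inj : injective (interp_incl Z).
Proof.
move=> h h' hh; apply/eqP; rewrite -subr_eq0 -normr_eq0.
have [I [u [l ul]]] := eigenbasis_ex.
rewrite (@interp_norm _ _ _ _ _ Z (h - h') 0) ?normr0//.
exists I, u, l; split=> // k.
have -> : interp_incl Z (h - h') = 0 by rewrite raddfB/= -hh subrr.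
by rewrite !ip0l mulr0.
Qed.

(** The estimate for [L^s] is carried over by [interp_norm]: [e = 1] gives boundedness of [iota],
    and arbitrary [e] the estimate behind compactness. *)
Lemma interp_embedding : exists iota : 'L(Y, Z),
  (forall y, interp_incl Z (iota y) = i y) /\
  forall e : R, 0 < e -> exists C, forall y, `|iota y| <= e * `|y| + C * `|i y|.
Proof.
have ex y : exists h, interp_incl Z h = i y.
  apply/(interp_dom Z); have [C _ /(_ y)[w ? _]] := frac_pow_ex ltr01.
  by exists w.
have [f fE] := choice ex.
have fe (e : R) : 0 < e -> exists2 C, 0 <= C & forall y, `|f y| <= e * `|y| + C * `|i y|.
  move=> e0; have [C C0 HC] := frac_pow_ex e0; exists C => // y.
  by have [w iyw] := HC y; rewrite (@interp_norm _ _ _ _ _ Z _ w)// fE.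
have fl : linear f.
  move=> a x y; apply: interp_incl_inj.
  by rewrite linearP !fE blinD blinZ.
have [C C0 HC] := fe 1 ltr01.
have fb y : `|f y| <= (1 + C * `|i|) * `|y|.
  apply: le_trans (HC y) _; rewrite mulrDl lerD2l -mulrA ler_wpM2l//.
  exact: blin_normP.
have [iota iE] := blin_ex fl fb.
exists iota; split=> [y|e /fe[D _ HD]]; first by rewrite iE.
by exists D => y; rewrite iE.
Qed.

End Interpolation.

(** * Calculus *)

Section Calculus.
Context {R : realType}.
Implicit Types V W X Y Z : normedModType R.

Lemma Diff_unique V W (f : V -> W) x (L : 'L(V, W)) :
  (forall e : R, 0 < e -> \forall h \near 0, `|f (h + x) - (f x + L h)| <= e * `|h|) ->
  differentiable f x /\ Diff f x = L.
Proof.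
move=> fL.
have E : f \o shift x = cst (f x) + L +o_ 0 id by apply/eqaddoP.
have dE : 'd f x = L :> (V -> W).
  by apply: (@diff_unique _ _ _ _ (blfun L)) => //; exact: blin_continuous.
have df : differentiable f x.
  by apply/diff_locallyP; rewrite dE; split=> //; exact: blin_continuous.
by split=> //; apply: blin_ext => y; rewrite DiffE// dE.
Qed.

Lemma DiffP V W (f : V -> W) x : differentiable f x ->
  forall e : R, 0 < e -> \forall h \near 0, `|f (h + x) - (f x + Diff f x h)| <= e * `|h|.
Proof.
by move=> df; have := diff_locally df; rewrite -(DiffE df) => /eqaddoP.
Qed.

Lemma Diff_near V W (f g : V -> W) x : (\forall y \near x, f y = g y) ->
  differentiable f x -> differentiable g x /\ Diff g x = Diff f x.
Proof.
move=> fg df; apply: Diff_unique => e e0.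
have fgx : f x = g x := nbhs_singleton fg.
have : \forall h \near 0, f (h + x) = g (h + x).
  by move: fg; rewrite (near_shift 0) /= => fg; near=> h; rewrite -[x]subr0; near: h.
move: (DiffP df e0); apply: filter_app2; near=> h => fh <-.
by rewrite -fgx.
Unshelve. all: by end_near. Qed.

Lemma Diff_comp V W Z (f : V -> W) (g : W -> Z) x :
  differentiable f x -> differentiable g (f x) ->
  Diff (g \o f) x = bcomp (Diff g (f x)) (Diff f x).
Proof.
move=> df dg; apply: blin_ext => v.
by rewrite bcompE (DiffE df) (DiffE dg) (DiffE (differentiable_comp df dg)) diff_comp.
Qed.

Lemma blin_differentiable V W (L : 'L(V, W)) x : differentiable L x.
Proof. exact/linear_differentiable/blin_continuous. Qed.

Lemma Diff_blin V W (L : 'L(V, W)) x : Diff L x = L.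
Proof.
apply: blin_ext => v; rewrite (DiffE (blin_differentiable L x)).
by rewrite diff_lin//; exact: blin_continuous.
Qed.

Lemma cvg_blin_apply (T : Type) (F : set_system T) (FF : Filter F) Y Z
    (f : T -> 'L(Y, Z)) (g : T -> Y) (f0 : 'L(Y, Z)) (g0 : Y) :
  f @ F --> f0 -> g @ F --> g0 -> (fun q => f q (g q)) @ F --> f0 g0.
Proof.
move=> ff gg; apply/cvgrPdist_le => e e0; near=> q.
have -> : f0 g0 - f q (g q) = f0 (g0 - g q) + (f0 - f q) (g q).
  by rewrite blinB [(f0 - f q) _]/(f0 (g q) - f q (g q)) addrA subrK.
apply: le_trans (ler_normD _ _) _; rewrite [e]splitr; apply: lerD.
  apply: le_trans (blin_normP _ _) _.
  apply: (@le_trans _ _ ((`|f0| + 1) * `|g0 - g q|)); first by rewrite ler_wpM2r// lerDl.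
  rewrite -ler_pdivlMl ?ltr_wpDl//; near: q; apply: cvgr_dist_le gg _ _.
  by rewrite mulr_gt0 ?invr_gt0 ?ltr_wpDl// divr_gt0.
apply: le_trans (blin_normP _ _) _.
apply: (@le_trans _ _ (`|f0 - f q| * (`|g0| + 1))).
  rewrite ler_wpM2l//.
  have : `|g0 - g q| <= 1 by near: q; exact: cvgr_dist_le gg _ _.
  have : `|g q| <= `|g0 - g q| + `|g0| by rewrite -{1}[g q](subrK g0) distrC ler_normD.
  by move: (`|g q|) (`|g0 - g q|) (`|g0|) => a b c; clear; lra.
rewrite -ler_pdivlMr ?ltr_wpDl//; near: q; apply: cvgr_dist_le ff _ _.
by rewrite mulr_gt0 ?invr_gt0 ?ltr_wpDl// divr_gt0.
Unshelve. all: by end_near. Qed.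

Section Bilinear.
Variables (V X Y Z : normedModType R) (B : 'L(X, 'L(Y, Z))).

Let b (x : X) (y : Y) : Z := B x y.

Let b_bilinear : bilinear_for (GRing.Scale.Law.clone _ _ *:%R _)
  (GRing.Scale.Law.clone _ _ *:%R _) b.
Proof.
by split=> [y a x x'|x a y y']; rewrite /b linearP.
Qed.

HB.instance Definition _ := bilinear_isBilinear.Build R X Y Z _ _ b b_bilinear.

Let b_continuous : continuous (fun p : X * Y => b p.1 p.2).
Proof.
move=> p; apply: cvg_blin_apply; last exact: cvg_snd.
by apply: continuous_comp; [exact: cvg_fst|exact: blin_continuous].
Qed.

Lemma Diff_bilin (f : V -> X) (g : V -> Y) x :
  differentiable f x -> differentiable g x ->
  differentiable (fun q => B (f q) (g q)) x /\
  forall v, Diff (fun q => B (f q) (g q)) x v =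
    B (Diff f x v) (g x) + B (f x) (Diff g x v).
Proof.
move=> df dg.
have dp : differentiable (fun q => (f q, g q)) x by exact: differentiable_pair.
have db := @differentiable_bilin _ _ _ _ b (f x, g x) b_continuous.
have dfg : differentiable (fun q => B (f q) (g q)) x by exact: (differentiable_comp dp db).
split=> // v; rewrite (DiffE dfg) (DiffE df) (DiffE dg).
have -> : 'd (fun q : V => B (f q) (g q)) x =
    'd ((fun p : X * Y => b p.1 p.2) \o (fun q => (f q, g q))) x by [].
rewrite (diff_comp dp db) (diff_bilin _ b_continuous).
by rewrite /= (diff_pair df dg)/= addrC.
Qed.

End Bilinear.

(** * Continuity and C1 regularity on open sets *)

Section OpenDomain.
Variables (V : normedModType R) (U : set V).
Hypothesis oU : open U.

Lemma within_open_continuousP (T : topologicalType) (f : V -> T) :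
  {within U, continuous f} <-> forall x, U x -> {for x, continuous f}.
Proof.
rewrite continuous_open_subspace//; split=> h x; first by move=> Ux; apply: h; rewrite inE.
by rewrite inE; exact: h.
Qed.

Lemma within_continuous_ext (T : topologicalType) (f g : V -> T) :
  (forall x, U x -> f x = g x) -> {within U, continuous f} -> {within U, continuous g}.
Proof.
move=> fg /within_open_continuousP cf; apply/within_open_continuousP => x Ux.
have nU : \forall y \near x, U y by apply: open_nbhs_nbhs.
apply: (@cvg_trans _ (f @ x)).
  by apply: near_eq_cvg; near=> y; rewrite fg//; near: y.
by rewrite -fg//; exact: cf.
Unshelve. all: by end_near. Qed.

Lemma within_continuous_bilin X Y Z (B : 'L(X, 'L(Y, Z))) (f : V -> X) (g : V -> Y) :
  {within U, continuous f} -> {within U, continuous g} ->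
  {within U, continuous (fun q => B (f q) (g q))}.
Proof.
move=> /within_open_continuousP cf /within_open_continuousP cg.
apply/within_open_continuousP => x Ux; apply: cvg_blin_apply; last exact: cg.
by apply: continuous_comp; [exact: cf|exact: blin_continuous].
Qed.

Lemma within_continuous_blin X Y (L : 'L(X, Y)) (f : V -> X) :
  {within U, continuous f} -> {within U, continuous (fun q => L (f q))}.
Proof.
move=> /within_open_continuousP cf; apply/within_open_continuousP => x Ux.
by apply: continuous_comp; [exact: cf|exact: blin_continuous].
Qed.

Lemma within_continuousD X (f g : V -> X) :
  {within U, continuous f} -> {within U, continuous g} ->
  {within U, continuous (fun q => f q + g q)}.
Proof.
move=> /within_open_continuousP cf /within_open_continuousP cg.
by apply/within_open_continuousP => x Ux; apply: cvgD; [exact: cf|exact: cg].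
Qed.

Lemma C1_continuous X (f : V -> X) : C1_on U f -> {within U, continuous f}.
Proof.
move=> [df _]; apply/within_open_continuousP => x Ux.
exact/differentiable_continuous/df.
Qed.

Lemma C1_ext X (f g : V -> X) : (forall x, U x -> f x = g x) ->
  C1_on U f -> C1_on U g /\ forall x, U x -> Diff g x = Diff f x.
Proof.
move=> fg [df cf].
have D x : U x -> differentiable g x /\ Diff g x = Diff f x.
  move=> Ux; apply: Diff_near (df x Ux).
  have nU : \forall y \near x, U y by apply: open_nbhs_nbhs.
  by near=> y; apply: fg; near: y.
split=> [|x /D[]//]; split=> [x /D[]//|].
by apply: within_continuous_ext cf => x /D[_ ->].
Unshelve. all: by end_near. Qed.

Lemma C1_bilin X Y Z (B : 'L(X, 'L(Y, Z))) (f : V -> X) (g : V -> Y) :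
  C1_on U f -> C1_on U g -> C1_on U (fun q => B (f q) (g q)).
Proof.
move=> Cf Cg; have [df cf] := Cf; have [dg cg] := Cg.
have D x (Ux : U x) := Diff_bilin B (df x Ux) (dg x Ux).
split=> [x /D[]//|].
(* The Leibniz rule as an identity between operators: the derivative is again a sum of bilinear
   expressions. *)
apply: (@within_continuous_ext _ (fun x => bcomp (bflip B (g x)) (Diff f x) +
                                        bcomp (B (f x)) (Diff g x))).
  by move=> x /D[_ E]; apply: blin_ext => v; rewrite E blin_addE !bcompE bflipE.
apply: within_continuousD; apply: within_continuous_bilin => //;
  by apply: within_continuous_blin; exact: C1_continuous.
Qed.

End OpenDomain.

Section Composition.
Variables (V W : normedModType R) (U : set V) (U' : set W) (phi : V -> W).
Hypotheses (oU : open U) (oU' : open U') (phiU : forall q, U q -> U' (phi q)).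

Lemma continuous_within_comp (T : topologicalType) (f : W -> T) :
  {within U, continuous phi} -> {within U', continuous f} ->
  {within U, continuous (f \o phi)}.
Proof.
move=> /(within_open_continuousP oU) cphi /(within_open_continuousP oU') cf.
apply/(within_open_continuousP oU) => x Ux.
by apply: continuous_comp; [exact: cphi|exact/cf/phiU].
Qed.

Lemma C1_comp X (f : W -> X) : C1_on U phi -> C1_on U' f ->
  C1_on U (f \o phi) /\
  forall q, U q -> Diff (f \o phi) q = bcomp (Diff f (phi q)) (Diff phi q).
Proof.
move=> Cphi [df cf]; have [dphi cdphi] := Cphi.
have E q : U q -> Diff (f \o phi) q = bcomp (Diff f (phi q)) (Diff phi q).
  by move=> Uq; apply: Diff_comp; [exact: dphi|exact/df/phiU].
split=> //; split.
  by move=> q Uq; apply: differentiable_comp; [exact: dphi|exact/df/phiU].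
apply: (within_continuous_ext oU (fun q Uq => esym (E q Uq))).
apply: within_continuous_bilin => //.
by apply: continuous_within_comp => //; exact: C1_continuous.
Qed.

(** By the chain rule [Diff (f \o phi)] is the bilinear expression [bcomp] in two C1 maps, to which
    the Leibniz rule applies. *)
Lemma C2_comp X (f : W -> X) : C2_on U phi -> C2_on U' f ->
  C2_on U (f \o phi) /\
  forall q, U q -> forall v w, Diff2 (f \o phi) q v w =
    Diff2 f (phi q) (Diff phi q v) (Diff phi q w) + Diff f (phi q) (Diff2 phi q v w).
Proof.
move=> [C1phi C2phi] [C1f C2f].
have [C1c E] := C1_comp C1phi C1f.
have [C1df E2] := C1_comp C1phi C2f.
have C1b := C1_bilin oU bcomp C1df C2phi.
have [C2c E3] := C1_ext oU (fun q Uq => esym (E q Uq)) C1b.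
split=> // q Uq v w; rewrite /Diff2 E3//.
have [_ ->] := Diff_bilin bcomp (C1df.1 q Uq) (C2phi.1 q Uq).
by rewrite blin_addE !bcompE E2// bcompE.
Qed.

End Composition.

Lemma C1_on_blin V W (U : set V) (L : 'L(V, W)) : C1_on U L.
Proof.
split=> [x _|]; first exact: blin_differentiable.
have -> : Diff L = cst L by apply/funext => x; exact: Diff_blin.
exact/continuous_subspaceT/cst_continuous.
Qed.

Lemma Diff_left_inverse V W (U : set V) (U' : set W)
    (f : V -> W) (g : W -> V) : open U -> open U' -> (forall q, U q -> U' (f q)) ->
  C1_on U f -> C1_on U' g -> (forall q, U q -> g (f q) = q) ->
  forall q, U q -> forall v, Diff g (f q) (Diff f q v) = v.
Proof.
move=> oU oU' fU Cf Cg gf q Uq v; have [_ /(_ q Uq) E] := C1_comp oU oU' fU Cf Cg.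
have [|_ /(_ q Uq)] := @C1_ext _ U oU _ (bid V) (g \o f) _ (C1_on_blin _ _).
  by move=> x Ux /=; rewrite bidE gf.
rewrite E Diff_blin => /(congr1 (fun h : 'L(V, V) => h v)).
by rewrite bcompE bidE.
Qed.

Lemma Diff_inverse_bijective V W (U : set V) (U' : set W)
    (f : V -> W) (g : W -> V) : open U -> open U' ->
  (forall q, U q -> U' (f q)) -> (forall p, U' p -> U (g p)) ->
  C1_on U f -> C1_on U' g ->
  (forall q, U q -> g (f q) = q) -> (forall p, U' p -> f (g p) = p) ->
  forall q, U q -> cancel (Diff f q) (Diff g (f q)) /\ cancel (Diff g (f q)) (Diff f q).
Proof.
move=> oU oU' fU gU' Cf Cg gf fg q Uq; split=> v.
  exact: (Diff_left_inverse oU oU' fU Cf Cg gf).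
rewrite -[in Diff f q](gf q Uq).
exact: (Diff_left_inverse oU' oU gU' Cg Cf fg (fU q Uq)).
Qed.

End Calculus.

(** * Composition with Floeromorphisms *)

Section PullbackHessian.
Context {R : realType}.
Variables (E2 E1 : hilbertType R) (S M : normedModType R).
Variables (tr : 'L('L(M, M), 'L(E1, E1))) (iota : 'L(E2, S)).

(** One formula for both levels. On the first, [E2, E1, S, M] are [H1, H0, Hs, H0] and [tr] is
    [adj]; on the second, they are [H2, H1, H1s, Hm1] and [tr] is the transpose. *)
Definition pullback_hessian (D : 'L(M, M)) (D2 : 'L(S, 'L(M, M)))
    (dphi : 'L(E2, E2)) (A : 'L(E2, E1)) (g : E1) : 'L(E2, E1) :=
  bcomp (tr D) (bcomp A dphi) +
  bcomp (beval E1 E1 g) (bcomp tr (bflip bcomp iota D2)).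

Lemma pullback_hessianE D D2 dphi A g x : pullback_hessian D D2 dphi A g x =
  tr D (A (dphi x)) + tr (D2 (iota x)) g.
Proof. by rewrite blin_addE !bcompE bevalE bflipE bcompE. Qed.

Lemma pullback_hessian_continuous (V : normedModType R) (U : set V)
    (D : V -> 'L(M, M)) (D2 : V -> 'L(S, 'L(M, M)))
    (dphi : V -> 'L(E2, E2)) (A : V -> 'L(E2, E1)) (g : V -> E1) : open U ->
  {within U, continuous D} -> {within U, continuous D2} ->
  {within U, continuous dphi} -> {within U, continuous A} ->
  {within U, continuous g} ->
  {within U, continuous
    (fun q => pullback_hessian (D q) (D2 q) (dphi q) (A q) (g q))}.
Proof.
move=> oU cD cD2 cd cA cg; apply: (within_continuousD oU).
  apply: (within_continuous_bilin oU (B := bcomp) (f := fun q => tr (D q))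
    (g := fun q => bcomp (A q) (dphi q))); first exact: within_continuous_blin.
  exact: (within_continuous_bilin oU (B := bcomp) (f := A) (g := dphi)).
apply: (within_continuous_bilin oU (B := bcomp) (f := fun q => beval E1 E1 (g q))
  (g := fun q => bcomp tr (bflip bcomp iota (D2 q)))); first exact: within_continuous_blin.
do 2!apply: (within_continuous_blin oU); exact: cD2.
Qed.

(** The second summand factors as [k] after [iota], hence inherits the estimate on [iota] and is
    totally bounded. *)
Lemma pullback_hessian_fredholm (Y : normedModType R) (i : 'L(E2, Y))
    (D : 'L(M, M)) (D2 : 'L(S, 'L(M, M))) (dphi : 'L(E2, E2)) (A : 'L(E2, E1)) (g : E1) :
  totally_bounded_op i ->
  (forall e : R, 0 < e -> exists C, forall y, `|iota y| <= e * `|y| + C * `|i y|) ->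
  bijective (tr D) -> bijective dphi -> fredholm_of_index A 0 ->
  fredholm_of_index (pullback_hessian D D2 dphi A g) 0.
Proof.
move=> ic ii bD bd fA; pose k := bcomp (beval E1 E1 g) (bcomp tr D2).
have kE x : k (iota x) = tr (D2 (iota x)) g by rewrite !bcompE bevalE.
apply: (fredholm0_compact_perturbation (K := bcomp k iota) fA bD bd) => [|x]; last first.
  by rewrite pullback_hessianE bcompE kE.
apply: (totally_bounded_ehrling ic) => e e0.
have k1 : 0 < `|k| + 1 by rewrite ltr_wpDl.
have [C HC] := ii (e / (`|k| + 1)) ltac:(by rewrite divr_gt0).
exists ((`|k| + 1) * C) => x; rewrite bcompE.
apply: le_trans (blin_normP _ _) _.
apply: (@le_trans _ _ ((`|k| + 1) * `|iota x|)); first by rewrite ler_wpM2r// lerDl.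
apply: (@le_trans _ _ ((`|k| + 1) * (e / (`|k| + 1) * `|x| + C * `|i x|))).
  by rewrite ler_wpM2l// ltW.
by rewrite mulrDr !mulrA [_ * e]mulrC mulfK// gt_eqF.
Qed.

End PullbackHessian.

(** * Duality between [H_{-1}] and [H_1] *)

Section NegativeSpace.
Context {R : realType} (T : hilbert_triple R) (N : neg_completion T).

Let i10_inj : injective (i10 T). Proof. by case: (i10P T). Qed.

(** The quotients are [ip a xi / |xi|] up to sign, bounded by [|a|] through Cauchy-Schwarz, with
    equality at [xi = a]. When [H1] is trivial the supremum is that of the empty set, namely 0. *)
Lemma jm1_normE (eta : H0 T) : `|jm1 N eta| = `|adj (i10 T) eta|.
Proof.
set a := adj (i10 T) eta; rewrite jm1_norm; set S := [set _ | _ in _].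
have Sa x : S x -> x <= `|a|.
  move=> [xi /= xi0 <-]; rewrite ler_pdivrMr ?normr_gt0// -adjE.
  exact: cauchy_schwarz.
apply/eqP; rewrite eq_le; apply/andP; split.
  have [->|/set0P S0] := eqVneq S set0; first by rewrite sup0.
  by apply: ge_sup => // x; exact: Sa.
have [a0|a0] := eqVneq a 0.
  have [->|/set0P[x Sx]] := eqVneq S set0; first by rewrite sup0 a0 normr0.
  rewrite a0 normr0; apply: (@le_trans _ _ x).
    by case: Sx => xi _ <-; rewrite divr_ge0.
  by apply: ub_le_sup => //; exists `|a|.
apply: ub_le_sup; first by exists `|a|.
exists a => //; rewrite -adjE -/a -sqr_normE ger0_norm ?sqr_ge0//.
by rewrite expr2 mulfK// normr_eq0.
Qed.

(* The duality pairing identifies the dual of [H_{-1}] with [H_1]: [J] and [J']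
   are mutually inverse extensions by density of [jm1 eta |-> adj i10 eta] and of
   [adj i10 eta |-> jm1 eta], and the transpose of [B] is [adj (J B J')]. *)
Lemma transpose_ex : exists tr : 'L('L(Hm1 N, Hm1 N), 'L(H1 T, H1 T)),
  forall (B : 'L(Hm1 N, Hm1 N)) (D : 'L(H0 T, H0 T)),
    (forall eta, B (jm1 N eta) = jm1 N (D eta)) ->
    forall xi, i10 T (tr B xi) = adj D (i10 T xi).
Proof.
pose i' := adj (i10 T).
have [||||J JE _] := @graph_extension _ (Hm1 N) (H1 T)
    (fun x z => exists2 eta, x = jm1 N eta & z = i' eta) 1.
- exact: ler01.
- move=> a x y z w [e -> ->] [e' -> ->]; exists (a *: e + e').
    by rewrite linearP.
  by rewrite blinD blinZ.
- by move=> _ _ [e -> ->]; rewrite mul1r jm1_normE.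
- move=> x e e0; have [_ [eta _ <-] xe] := dense_norm (@jm1_dense _ _ N) x e0.
  by exists (jm1 N eta); split=> //; exists (i' eta), eta.
have [||||J' J'E _] := @graph_extension _ (H1 T) (Hm1 N)
    (fun x z => exists2 eta, x = i' eta & z = jm1 N eta) 1.
- exact: ler01.
- move=> a x y z w [e -> ->] [e' -> ->]; exists (a *: e + e').
    by rewrite blinD blinZ.
  by rewrite linearP.
- by move=> _ _ [e -> ->]; rewrite mul1r jm1_normE.
- move=> x e e0.
  have [_ [eta _ <-] xe] := dense_norm (dense_range_adj i10_inj) x e0.
  by exists (i' eta); split=> //; exists (jm1 N eta), eta.
exists (bcomp adj (bcomp (bflip bcomp J') (bcomp J))) => B D BD xi.
(* Tested against [eta], both sides become the pairing of [D eta] with [i10 T xi], because [J (B (J'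
   (adj i10 eta))) = adj i10 (D eta)]. *)
apply: ip_inj => eta; rewrite adjEr -adjE bcompE adjEr bcompE bflipE !bcompE.
rewrite (J'E _ (jm1 N eta)); last by exists eta.
by rewrite BD (JE _ (i' (D eta))) ?adjE//; exists (D eta).
Qed.

End NegativeSpace.

(** * The pullback of a Floer function *)

Section Main.
Context {R : realType} (T : hilbert_triple R) (N : neg_completion T) (s : R).
Context (Hs : interp_space (i10 T) s) (H1s : interp_space (i21 T) s).
Hypothesis s01 : 0 <= s < 1.
Variables (U V : set (H1 T)) (openU : open U) (openV : open V).

Let openU2 : open (level2 U).
Proof. by apply: open_comp => // x _; exact: blin_continuous. Qed.

Let openV2 : open (level2 V).
Proof. by apply: open_comp => // x _; exact: blin_continuous. Qed.

Let i10_inj : injective (i10 T). Proof. by case: (i10P T). Qed.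

Let i21_inj : injective (i21 T). Proof. by case: (i21P T). Qed.

Let i10_dense : dense (range (i10 T)). Proof. by case: (i10P T). Qed.

(** The chain rule on both sides of [i21 \o phi2 = phi \o i21]. *)
Lemma level2_Diff (phi : H1 T -> H1 T) (phi2 : H2 T -> H2 T) :
  C1_on U phi -> C1_on (level2 U) phi2 ->
  (forall q, level2 U q -> i21 T (phi2 q) = phi (i21 T q)) ->
  forall q, level2 U q -> forall xi,
    i21 T (Diff phi2 q xi) = Diff phi (i21 T q) (i21 T xi).
Proof.
move=> Cphi Cphi2 E q Uq xi.
have [C1a Ea] := C1_comp openU2 openU (fun q Uq => Uq) (C1_on_blin _ (i21 T)) Cphi.
have [_ Eb] := C1_comp openU2 openT (fun q _ => Logic.I) Cphi2 (C1_on_blin setT (i21 T)).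
have [_ /(_ q Uq)] := C1_ext openU2 (fun q Uq => esym (E q Uq)) C1a.
rewrite (Ea q Uq) -[Diff _ q]/(Diff (i21 T \o phi2) q) (Eb q Uq) !Diff_blin.
by move=> /(congr1 (fun h : 'L(H2 T, H1 T) => h xi)); rewrite !bcompE.
Qed.

Lemma extension_cancel (B C : 'L(H1 T, H1 T)) (D E : 'L(H0 T, H0 T)) :
  (forall xi, D (i10 T xi) = i10 T (B xi)) ->
  (forall xi, E (i10 T xi) = i10 T (C xi)) -> cancel B C -> cancel D E.
Proof.
move=> DB EC BC x.
have : bcomp E D = bid (H0 T).
  apply: (eq_blin_dense i10_dense) => _ [xi _ <-].
  by rewrite bcompE bidE DB EC BC.
by move=> /(congr1 (fun h : 'L(H0 T, H0 T) => h x)); rewrite bcompE bidE.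
Qed.

Lemma adj_cancel (X : hilbertType R) (D E : 'L(X, X)) :
  cancel D E -> cancel (adj E) (adj D).
Proof. by move=> DE x; apply: ip_inj => y; rewrite !adjEr DE. Qed.

Lemma floer_function_comp (phi : H1 T -> H1 T) (f : H1 T -> R^o) :
  floeromorphism N Hs H1s U V phi -> floer_function V f ->
  floer_function U (f \o phi).
Proof.
move=> [[[phiU C2phi [phi2 [phi2E C2phi2]]] [D [Dm [D2 [D2m]]]]]].
move=> [[DE C1D] [DmE C1Dm] [D2E cD2] [D2mE cD2m]].
move=> [psi [[[psiV C2psi [psi2 [psi2E C2psi2]]] [D' [Dm' [D2' [D2m']]]]]]].
move=> [[D'E _] [Dm'E _] _ _] psiphi phipsi.
move=> [C2f [g [gE C1g [g2 [g2E C1g2]]]] [A [AE cA fA [A2 [A2E cA2 fA2]]]]].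
have [C1phi _] := C2phi; have [C1psi _] := C2psi; have [C1f _] := C2f.
have [C1phi2 _] := C2phi2; have [C1psi2 _] := C2psi2.
have cdphi : {within U, continuous (Diff phi)} by case: C1phi.
have cdphi2 : {within level2 U, continuous (Diff phi2)} by case: C1phi2.
have phi2U q : level2 U q -> level2 V (phi2 q).
  by move=> Uq; rewrite /level2 /= phi2E//; exact: phiU.
have psi2V p : level2 V p -> level2 U (psi2 p).
  by move=> Vp; rewrite /level2 /= psi2E//; exact: psiV.
have psiphi2 q : level2 U q -> psi2 (phi2 q) = q.
  by move=> Uq; apply: i21_inj; rewrite psi2E ?phi2E ?psiphi//; exact: phi2U.
have phipsi2 p : level2 V p -> phi2 (psi2 p) = p.
  by move=> Vp; apply: i21_inj; rewrite phi2E ?psi2E ?phipsi//; exact: psi2V.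
have inv1 := Diff_inverse_bijective openU openV phiU psiV C1phi C1psi psiphi phipsi.
have inv2 := Diff_inverse_bijective openU2 openV2 phi2U psi2V C1phi2 C1psi2 psiphi2 phipsi2.
(* The extensions to [H0] inherit invertibility from the derivatives on [H1] by density. *)
have invD q : U q -> cancel (D q) (D' (phi q)) /\ cancel (D' (phi q)) (D q).
  move=> Uq; have [c1 c2] := inv1 q Uq.
  by split; [apply: extension_cancel c1|apply: extension_cancel c2];
    rewrite ?DE ?D'E// => xi; rewrite ?DE ?D'E//; exact: phiU.
have dphi2E := level2_Diff C1phi C1phi2 phi2E.
have [tr trE] := transpose_ex N.
have [iota [iotaE iota_c]] := interp_embedding Hs s01.
have [iota2 [iota2E iota2_c]] := interp_embedding H1s s01.
have i10_c : totally_bounded_op (i10 T).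
  by apply: compact_totally_bounded; case: (i10P T).
have i21_c : totally_bounded_op (i21 T).
  by apply: compact_totally_bounded; case: (i21P T).
have [C2F D2F] := C2_comp openU openV phiU C2phi C2f.
have [_ DF] := C1_comp openU openV phiU C1phi C1f.
have [C1gphi _] := C1_comp openU openV phiU C1phi C1g.
have [C1gphi2 _] := C1_comp openU2 openV2 phi2U C1phi2 C1g2.
split=> //.
- exists (fun q => adj (D q) (g (phi q))); split.
  + by move=> q Uq xi; rewrite DF// bcompE (gE _ (phiU q Uq)) adjE DE.
  + exact: (C1_bilin openU adj C1D C1gphi).
  + exists (fun q => tr (Dm q) (g2 (phi2 q))); split.
      move=> q Uq; rewrite (trE _ _ (DmE q Uq)) g2E; last exact: phi2U.
      by rewrite phi2E.
    exact: (C1_bilin openU2 tr C1Dm C1gphi2).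
- exists (fun q => pullback_hessian adj iota (D q) (D2 q) (Diff phi q)
                     (A (phi q)) (g (phi q))).
  split.
  (* The two terms of the second-order chain rule match the two summands; in the second one, [D2] at
     [iota xi] extends the second derivative of [phi] in the direction [xi]. *)
  + move=> q Uq xi eta; rewrite D2F// pullback_hessianE ipDl !adjE DE//.
    by rewrite (D2E q Uq (iota xi) xi)// -AE -?gE//; exact: phiU.
  + apply: pullback_hessian_continuous => //.
    * exact: (C1_continuous openU C1D).
    * exact: (continuous_within_comp openU openV phiU (C1_continuous openU C1phi) cA).
    * exact: (C1_continuous openU C1gphi).
  + move=> q Uq; have [c1 c2] := inv1 q Uq; have [d1 d2] := invD q Uq.
    apply: (pullback_hessian_fredholm _ _ i10_c iota_c).
    * by exists (adj (D' (phi q))); exact: adj_cancel.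
    * by exists (Diff psi (phi q)).
    * exact/fA/phiU.
  + exists (fun q => pullback_hessian tr iota2 (Dm q) (D2m q) (Diff phi2 q)
                       (A2 (phi2 q)) (g2 (phi2 q))); split.
    * move=> q Uq xi; rewrite !pullback_hessianE blinD.
      have Vq := phi2U q Uq.
      rewrite (trE _ _ (DmE q Uq)) A2E// dphi2E// phi2E//; congr (_ + _).
      (* [iota2 xi] and [iota (i21 T xi)] have the same image in [H0], so [D2m] extends [D2] here
         and [tr] of it is an adjoint on [H0]. *)
      have D2q eta : D2m q (iota2 xi) (jm1 N eta) =
          jm1 N (D2 (i21 T q) (iota (i21 T xi)) eta).
        by apply: D2mE => //; rewrite iotaE iota2E.
      by rewrite (trE _ _ D2q) g2E// phi2E.
    * apply: pullback_hessian_continuous => //.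
      - exact: (C1_continuous openU2 C1Dm).
      - exact: (continuous_within_comp openU2 openV2 phi2U (C1_continuous openU2 C1phi2) cA2).
      - exact: (C1_continuous openU2 C1gphi2).
    * move=> q Uq; have [c1 c2] := inv2 q Uq.
      have [d1 d2] := invD _ Uq; have Vq := phi2U q Uq.
      apply: (pullback_hessian_fredholm _ _ i21_c iota2_c).
      (* Through the injective [i10], the transposes of [Dm] and [Dm'] become the adjoints of [D]
         and [D'], which are mutually inverse. *)
      - have DmE' := Dm'E _ Vq; rewrite phi2E// in DmE'.
        exists (tr (Dm' (phi2 q))) => x; apply: i10_inj.
          by rewrite (trE _ _ DmE') (trE _ _ (DmE q Uq)) adj_cancel.
        by rewrite (trE _ _ (DmE q Uq)) (trE _ _ DmE') adj_cancel.
      - by exists (Diff psi2 (phi2 q)).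
      - exact/fA2.
Qed.

End Main.

Theorem theorem1 (R : realType) (T : hilbert_triple R) (N : neg_completion T)
    (s : R) (hs : 0 <= s < 1)
    (Hs : interp_space (i10 T) s) (H1s : interp_space (i21 T) s)
    (U1 V1 : set (H1 T)) (openU1 : open U1) (openV1 : open V1)
    (phi : H1 T -> H1 T) (hphi : floeromorphism N Hs H1s U1 V1 phi)
    (f : H1 T -> R^o) (hf : floer_function V1 f) :
  floer_function U1 (f \o phi).
Proof. exact: (floer_function_comp hs openU1 openV1 hphi hf). Qed.
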